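(* For every real $p>1$, \[ \nu(p,-1)=\mathbf{D}_{c(p)}\left[\left(\frac1p\delta_0+\frac{p-1}{p}\delta_1\right)^{\boxtimes p}\right], \] where $c(p)=p^p(p-1)^{1-p}$, and \[ \nu(p,0)=\mathbf{D}_{p}\left[\left(\left(\frac1p\delta_0+\frac{p-1}{p}\delta_1\right)^{\boxplus p/(p-1)}\right)^{\boxtimes (p-1)}\right]. \]
   Context: For $a\in\mathbb{R}$ and $n\in\{0,1,2,\ldots\}$, $\binom{a}{n}:=a(a-1)\cdots(a-n+1)/n!$ (with $\binom a0=1$). For $p\ge1$, $-1\le r\le p-1$, $\nu(p,r)$ denotes the unique probability measure with moments $\int x^n\,d\nu(p,r)(x)=\binom{np+r}{n}$, $n\ge0$; its support is compact and contained in $[0,\infty)$. $\delta_a$ is the unit point mass at $a$. Dilation: $\mathbf{D}_c\mu(A):=\mu(\frac1cA)$ for $c>0$ and Borel sets $A$. For a compactly supported probability measure $\mu\neq\delta_0$ on $[0,\infty)$, let $M_\mu(z)=\int\frac{1}{1-xz}\,d\mu(x)$ and let the $S$-transform $S_\mu$ be the function analytic near $z=0$ determined by $M_\mu\left(\frac{z}{1+z}S_\mu(z)\right)=1+z$ (so $S_\mu(0)=1/\int x\,d\mu(x)>0$); $S_\mu$ determines $\mu$. The multiplicative free power $\mu^{\boxtimes s}$ ($s>0$), when it exists, is the compactly supported probability measure on $[0,\infty)$ with $S_{\mu^{\boxtimes s}}(z)=S_\mu(z)^s$ (principal branch near $z=0$). The additive free power $\mu^{\boxplus t}$ ($t\ge1$)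 is the compactly supported probability measure on $[0,\infty)$ with $S_{\mu^{\boxplus t}}(z)=\frac1tS_\mu\left(\frac zt\right)$. *)

(* Defs.v *)
From HB Require Import structures.
From mathcomp Require Import all_boot all_order all_algebra.
From mathcomp Require Import complex.
From mathcomp Require Import all_classical all_reals all_analysis.

Set Implicit Arguments.
Unset Strict Implicit.
Unset Printing Implicit Defensive.

Import Order.TTheory GRing.Theory Num.Theory.
Import numFieldNormedType.Exports.

Local Open Scope classical_set_scope.
Local Open Scope ring_scope.
Local Open Scope complex_scope.

Notation probR R := (probability (measurableTypeR R) R).

Definition gbinom (R : realType) (a : R) (n : nat) : R :=
  (\prod_(i < n) (a - i%:R)) / n`!%:R.

(* Principal argument, in ]-pi, pi], for w != 0. *)
Definition carg (R : realType) (w : R[i]) : R :=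
  let t := acos (complex.Re w / ComplexField.Normc.normc w) in
  if 0 <= complex.Im w then t else - t.

(* Principal branch of w ^ s for w != 0, i.e. exp (s * Log w). *)
Definition cpow (R : realType) (w : R[i]) (s : R) : R[i] :=
  let r := (ComplexField.Normc.normc w) `^ s in
  (r * cos (s * carg w)) +i* (r * sin (s * carg w)).

(* Equality of Borel measures; the values of the underlying functions on
   non-measurable sets are irrelevant. *)
Definition same_measure (R : realType)
    (mu nu : set (measurableTypeR R) -> \bar R) : Prop :=
  forall A, measurable A -> mu A = nu A.

Definition msupport (R : realType) (mu : probR R) : set R :=
  [set x : R | forall U : set R, open U -> U x -> (0 < mu U)%E].

Definition compactly_supported_nneg (R : realType) (mu : probR R) : Prop :=
  compact (msupport mu) /\ msupport mu `<=` [set x | 0 <= x].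

Definition dilation (R : realType) (c : R)
    (mu : set (measurableTypeR R) -> \bar R) :
    set (measurableTypeR R) -> \bar R :=
  fun A => mu [set c^-1 * x | x in A].

(* nu is the measure nu(p, r). *)
Definition is_nu (R : realType) (p r : R) (nu : probR R) : Prop :=
  compactly_supported_nneg nu /\
  forall n : nat,
    (\int[nu]_x (x ^+ n)%:E = (gbinom (n%:R * p + r) n)%:E)%E.

(* M_mu(z) for complex z; the complex-valued integral is taken componentwise. *)
Definition Mtransform (R : realType) (mu : probR R) (z : R[i]) : R[i] :=
  (\int[mu]_x complex.Re (1 - x%:C * z)^-1) +i*
  (\int[mu]_x complex.Im (1 - x%:C * z)^-1).

(* S is (a representative of the germ at 0 of) the S-transform of mu;
   analyticity is complex differentiability near 0. *)
Definition is_Stransform (R : realType) (mu : probR R) (S : R[i] -> R[i]) :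
    Prop :=
  [/\ compactly_supported_nneg mu,
      ~ same_measure mu (\d_(0 : R)),
      \forall z \near (0 : R[i]^o), derivable (S : R[i]^o -> R[i]^o) z 1 &
      \forall z \near (0 : R[i]^o),
        Mtransform mu (z / (1 + z) * S z) = 1 + z].

(* rho is the multiplicative free power of mu with exponent s. *)
Definition is_free_mul_power (R : realType) (mu : probR R) (s : R)
    (rho : probR R) : Prop :=
  exists2 S : R[i] -> R[i],
    is_Stransform mu S & is_Stransform rho (fun z => cpow (S z) s).

(* sigma is the additive free power of mu with exponent t. *)
Definition is_free_add_power (R : realType) (mu : probR R) (t : R)
    (sigma : probR R) : Prop :=
  exists2 S : R[i] -> R[i],
    is_Stransform mu S &
    is_Stransform sigma (fun z => (t%:C)^-1 * S (z / t%:C)).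

Section two_atoms.
Context (R : realType) (p : R) (p1 : 1 < p).

Lemma weight0_ge0 : 0 <= 1 / p.
Proof. by rewrite divr_ge0// ltW// (lt_trans ltr01). Qed.

Lemma weight1_ge0 : 0 <= (p - 1) / p.
Proof. by rewrite divr_ge0// ?subr_ge0 ltW// (lt_trans ltr01). Qed.

Definition two_atoms : set (measurableTypeR R) -> \bar R :=
  measure_add (mscale (NngNum weight0_ge0) (\d_(0 : measurableTypeR R)))
              (mscale (NngNum weight1_ge0) (\d_(1 : measurableTypeR R))).

HB.instance Definition _ := Measure.on two_atoms.

Lemma two_atomsE A : two_atoms A =
  ((1 / p)%:E * \d_(0%R : R) A + ((p - 1) / p)%:E * \d_(1%R : R) A)%E.
Proof. by rewrite /two_atoms measure_addE. Qed.

Lemma two_atoms_setT : two_atoms setT = 1%E.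
Proof.
have p0 : p != 0 by rewrite gt_eqF// (lt_trans ltr01).
rewrite two_atomsE !diracT !mule1 -EFinD -mulrDl addrC subrK.
by rewrite divff.
Qed.

HB.instance Definition _ :=
  Measure_isProbability.Build _ _ _ two_atoms two_atoms_setT.

End two_atoms.

(* Main.v *)
(** By Lagrange inversion, the moment series of nu(p, -1) and nu(p, 0) at
    w = y (1 + y)^(-p) are 1 / (1 - (p - 1) y) and (1 + y) / (1 - (p - 1) y).
    Choosing for y the Moebius function of z that makes these equal to 1 + z
    exhibits the S-transforms of nu(p, -1) and nu(p, 0), up to dilation, as the
    powers p and p - 1 of the Moebius functions that are the S-transforms of the
    two-atom law and of its additive power. Hence rho is the dilation of nu.

    For Lagrange inversion, every (1 + y)^(-n p) is replaced by a partial sum of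
    its binomial series; the coefficient of y^N is then the N-th finite
    difference of a polynomial of degree N with leading coefficient
    (p - 1)^N / N!.

    The additive power sigma has to be constructed. It is the image under
    t |-> (2/p) (1 + cos t) of a density on [0, pi], plus an atom at p / (p - 1)
    when p > 2, such that (p - (p - 1) x) sigma(dx) is a dilated free Poisson law.
    The Catalan moments of the latter give a first-order recursion for the
    moments of sigma. *)
Require Import Defs.
From HB Require Import structures.
From mathcomp Require Import all_boot all_order all_algebra.
From mathcomp Require Import complex ring lra.
From mathcomp Require Import all_classical all_reals all_analysis.
From mathcomp Require Import measurable_realfun giry.
Set Implicit Arguments.
Unset Strict Implicit.
Unset Printing Implicit Defensive.
Import Order.TTheory GRing.Theory Num.Theory.
Import numFieldNormedType.Exports.
Import ComplexField.Normc.
Local Open Scope classical_set_scope.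
Local Open Scope ring_scope.
Local Open Scope complex_scope.
Local Notation Re := complex.Re.
Local Notation Im := complex.Im.
Local Arguments normc {R} x : simpl never.

(** * Complex norm and complex derivative *)

(** As nu is given, [rho] is taken to be its image under x |-> x / c: the identity of measures then
    holds by construction, and what has to be proved is the S-transform of [rho]. Moment series
    enter only through partial sums with error C / 2^N, and two such limits of the same partial sums
    coincide.

    The shape of [sigma] is read off its S-transform. With M = 1 + z and y = z / (p + (p - 1) z),
    the relation w = z / ((1 + z) (1 + y)) becomes (p w - (p - 1)) M^2 + (p - 2) M + 1 = 0, of
    discriminant p^2 (1 - 4 w / p). The square root accounts for the interval [0, 4 / p], the range
    of (2 / p) (1 + cos t). The leading coefficient vanishes at w = (p - 1) / p, which accounts for
    the possible atom at 1 / w = p / (p - 1). The factor p - (p - 1) x clears this coefficient and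
    leaves a pure square root, that is a free Poisson law. Conversely, summing the moment recursion
    gives an equation linear in M, so that no branch of the square root has to be selected. *)

Lemma is_derive_inv (K : numFieldType) (V : normedModType K) (f : V -> K)
    (x v : V) (df : K) : f x != 0 -> is_derive x v f df ->
  is_derive x v (fun y => (f y)^-1) (- (f x) ^- 2 *: df).
Proof.
move=> fx0 [dvf <-]; split; first exact: derivableV.
exact: deriveV.
Qed.

Section complex_norm.
Variable R : realType.
Implicit Types z w : R[i].

Lemma norm_normc z : `|z| = (normc z)%:C. Proof. by []. Qed.

Lemma ltr0C (x : R) : (0 < x%:C) = (0 < x).
Proof. exact: ltcR. Qed.

Lemma normc_ge0 z : 0 <= normc z.
Proof. by case: z => a b; exact: sqrtr_ge0. Qed.

Lemma normcD z w : normc (z + w) <= normc z + normc w.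
Proof. exact: (@le_normcD _ z w). Qed.

Lemma normc_opp z : normc (- z) = normc z.
Proof. exact: (@normcN _ z). Qed.

Lemma normcB z w : normc (z - w) <= normc z + normc w.
Proof. by rewrite (le_trans (normcD _ _))// normc_opp. Qed.

Lemma normc_distrC z w : normc (z - w) = normc (w - z).
Proof. by rewrite -normc_opp opprB. Qed.

Lemma lerB_normc z w : normc z - normc w <= normc (z + w).
Proof.
rewrite lerBlDr; have := normcB (z + w) w.
by rewrite addrK.
Qed.

Lemma normc_eq0 z : (normc z == 0) = (z == 0).
Proof. by apply/eqP/eqP => [/eq0_normc//|->]; rewrite normc0. Qed.

Lemma normc_gt0 z : (0 < normc z) = (z != 0).
Proof. by rewrite lt_neqAle normc_ge0 andbT eq_sym normc_eq0. Qed.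

Lemma normcX z n : normc (z ^+ n) = normc z ^+ n.
Proof. by elim: n => [|n IH]; rewrite ?expr0 ?normc1// !exprS normcM IH. Qed.

Lemma normc_real (x : R) : normc x%:C = `|x|.
Proof. by rewrite /normc/= expr0n/= addr0 sqrtr_sqr. Qed.

Lemma normc_Re z : `|Re z| <= normc z.
Proof. by have := normc_ge_Re z; rewrite lecR. Qed.

Lemma normc_Im z : `|Im z| <= normc z.
Proof.
case: z => a b /=; rewrite -sqrtr_sqr ler_wsqrtr// lerDr sqr_ge0//.
Qed.

Lemma normc_le z : normc z <= `|Re z| + `|Im z|.
Proof.
case: z => a b /=.
rewrite -[leRHS]ger0_norm ?addr_ge0// -sqrtr_sqr ler_wsqrtr//.
rewrite sqrrD !real_normK ?num_real// addrAC lerDl.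
by rewrite mulrn_wge0// mulr_ge0.
Qed.

Lemma normc_sum (I : Type) (r : seq I) (P : pred I) (F : I -> R[i]) :
  normc (\sum_(i <- r | P i) F i) <= \sum_(i <- r | P i) normc (F i).
Proof.
elim/big_ind2 : _ => //; first by rewrite normc0.
by move=> a b c d ab cd; rewrite (le_trans (normcD _ _))// lerD.
Qed.

(** A positive element of [R[i]] is real, so the radius of a complex ball is a real number and
    neighbourhoods can be handled with [normc]. *)
Lemma near0C (P : R[i] -> Prop) :
  (exists2 d : R, 0 < d & forall z, normc z < d -> P z) <->
  \forall z \near (0 : R[i]^o), P z.
Proof.
split.
  case=> d d0 dP; near=> z; apply: dP.
  rewrite -ltcR -norm_normc; near: z.
  have d0' : 0 < d%:C :> R[i] by rewrite ltr0C.
  exact: (@nbhs0_lt _ (R[i]^o) _ d0').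
move=> /nbhs_ballP[e /= e0 eP]; case: e e0 eP => e1 e2.
rewrite ltcE/= => /andP[/eqP -> e0] eP.
exists e1 => // z ze; apply: eP.
by rewrite -ball_normE/= sub0r normrN norm_normc ltcR.
Unshelve. all: end_near. Qed.

End complex_norm.

Section complex_derivative.
Variable R : realType.
Implicit Types (f : R[i] -> R[i]) (z w : R[i]).

(** Replaces a limit of quotients with tolerances in [R[i]] by a first-order expansion with real
    tolerances, in which h = 0 is no exception. *)
Lemma is_deriveCP f z d :
  is_derive (z : R[i]^o) 1 (f : R[i]^o -> R[i]^o) d <->
  forall e : R, 0 < e -> exists2 dl : R, 0 < dl &
    forall h, normc h < dl -> normc (f (z + h) - f z - h * d) <= e * normc h.
Proof.
have quot h : h != 0 ->
    normc (f (z + h) - f z - h * d) =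
    normc (h^-1 * (f (h * 1 + z) - f z) - d) * normc h.
  move=> h0; rewrite -normcM mulrBl mulrAC mulVf// mul1r mulr1.
  by rewrite [z + h]addrC [d * h]mulrC.
split.
  move=> [/cvg_ex[l fl] dE] e e0.
  have : h^-1 *: (f (h *: 1 + z) - f z : R[i]^o) @[h --> (0 : R[i]^o)^'] -->
      (d : R[i]^o).
    suff -> : d = l by exact: fl.
    by rewrite -dE; apply/cvg_lim => //; exact: (@norm_hausdorff _ R[i]^o).
  move=> /cvgrPdist_le dq; have := dq e%:C; rewrite ltr0C => /(_ e0).
  rewrite /dnbhs/= /within/=.
  move=> /near0C[dl dl0 H]; exists dl => // h hdl.
  have [->|h0] := eqVneq h 0.
    by rewrite addr0 subrr mul0r subrr normc0 mulr0.
  rewrite quot// ler_wpM2r ?normc_ge0//.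
  have := H h hdl h0; rewrite norm_normc lecR.
  by rewrite normc_distrC.
move=> H.
have fl : h^-1 *: (f (h *: 1 + z) - f z : R[i]^o) @[h --> (0 : R[i]^o)^'] -->
    (d : R[i]^o).
  apply/cvgrPdist_le => /= -[e1 e2]; rewrite ltcE/= => /andP[/eqP -> e0].
  have [dl dl0 Hdl] := H _ e0.
  rewrite /dnbhs/= /within/=.
  apply/near0C; exists dl => // h hdl h0.
  rewrite norm_normc lecR normc_distrC.
  rewrite -(ler_pM2r (_ : 0 < normc h)) ?normc_gt0//.
  by rewrite -quot//; exact: Hdl.
split; first by apply/cvg_ex; exists d.
by apply/cvg_lim => //; exact: (@norm_hausdorff _ R[i]^o).
Qed.

Lemma is_deriveC_quadratic f z d (C dl : R) : 0 < dl -> 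
  (forall h, normc h < dl -> normc (f (z + h) - f z - h * d) <= C * normc h ^+ 2) ->
  is_derive (z : R[i]^o) 1 (f : R[i]^o -> R[i]^o) d.
Proof.
move=> dl0 H; apply/is_deriveCP => e e0.
have C0 : 0 < `|C| + 1 by rewrite ltr_wpDl.
exists (Num.min dl (e / (`|C| + 1))); first by rewrite lt_min dl0 divr_gt0.
move=> h; rewrite lt_min => /andP[h1 h2].
rewrite (le_trans (H _ h1))// expr2 mulrA ler_wpM2r ?normc_ge0//.
rewrite ltr_pdivlMr// in h2.
rewrite (le_trans _ (ltW h2))// mulrC ler_wpM2l ?normc_ge0//.
by rewrite (le_trans (ler_norm _))// lerDl.
Qed.

Lemma is_derive_ray f (z d : R[i]) (t : R) :
  is_derive (t%:C * z : R[i]^o) 1 (f : R[i]^o -> R[i]^o) d ->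
  is_derive t 1 (fun t : R => Re (f (t%:C * z))) (Re (z * d)) /\
  is_derive t 1 (fun t : R => Im (f (t%:C * z))) (Im (z * d)).
Proof.
move=> /is_deriveCP H.
have key (e : R) : 0 < e -> \forall h \near 0^',
    normc (h^-1%:C * (f ((h * 1 + t)%:C * z) - f (t%:C * z)) - z * d) <= e.
  (* The added 1 keeps the tolerance e / (|z| + 1) meaningful when z = 0. *)
  move=> e0; have z0 : 0 < normc z + 1 by rewrite ltr_wpDl ?normc_ge0.
  have [dl dl0 Hdl] := H (e / (normc z + 1)) ltac:(by rewrite divr_gt0).
  near=> h.
  have h0 : h != 0 by near: h; exact: nbhs_dnbhs_neq.
  have hdl : normc (h%:C * z) < dl.
    rewrite normcM normc_real.
    rewrite (@le_lt_trans _ _ (`|h| * (normc z + 1)))//.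
      by rewrite ler_wpM2l// lerDl.
    rewrite -ltr_pdivlMr//; near: h.
    by apply: dnbhs0_lt; rewrite divr_gt0.
  have hC0 : 0 < `|h| by rewrite normr_gt0.
  rewrite -(ler_pM2r hC0) -normc_real -normcM mulrBl mulrAC -rmorphM mulVf//.
  rewrite mul1r mulr1 rmorphD/= mulrDl addrC -[z * d * _]mulrC mulrA.
  rewrite [h%:C * z + _]addrC addrC (le_trans (Hdl _ hdl))//.
  rewrite mulrAC ler_pdivrMr// normcM !normc_real -!mulrA.
  by apply: ler_wpM2l; [exact: ltW|rewrite ler_wpM2l// lerDl].
split.
  suff K : h^-1 *: ((fun t : R => Re (f (t%:C * z))) (h *: 1 + t) - Re (f (t%:C * z)))
      @[h --> 0^'] --> Re (z * d).
    by split; [apply/cvg_ex; exists (Re (z * d))|exact/cvg_lim].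
  apply/cvgrPdist_le => /= e e0; have := key e e0; apply: filterS => h.
  apply: le_trans; rewrite distrC (le_trans _ (normc_Re _))//.
  rewrite /GRing.scale/=; move: (f _) (f _) (z * d) => [? ?] [? ?] [? ?] /=.
  by rewrite mul0r subr0.
suff K : h^-1 *: ((fun t : R => Im (f (t%:C * z))) (h *: 1 + t) - Im (f (t%:C * z)))
    @[h --> 0^'] --> Im (z * d).
  by split; [apply/cvg_ex; exists (Im (z * d))|exact/cvg_lim].
apply/cvgrPdist_le => /= e e0; have := key e e0; apply: filterS => h.
apply: le_trans; rewrite distrC (le_trans _ (normc_Im _))//.
rewrite /GRing.scale/=; move: (f _) (f _) (z * d) => [? ?] [? ?] [? ?] /=.
by rewrite mul0r addr0.
Unshelve. all: end_near. Qed.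

Lemma real_mvt_bound (f df : R -> R) (B : R) :
  (forall t : R, 0 <= t <= 1 -> is_derive t 1 f (df t)) ->
  (forall t : R, 0 <= t <= 1 -> `|df t| <= B) -> `|f 1 - f 0| <= B.
Proof.
move=> fdf dfB; have [||c c01 ->] := @MVT_segment _ f df 0 1 ler01.
- move=> x; rewrite in_itv/= => /andP[x0 x1].
  by apply: fdf; rewrite !ltW.
- apply: derivable_within_continuous => x; rewrite in_itv/= => /fdf.
  by case.
- by rewrite subr0 mulr1 dfB//; rewrite in_itv/= in c01.
Qed.

(** The mean value theorem fails for complex values, so it is applied to the real and imaginary
    parts along the segment from 0 to z; hence the factor 2. *)
Lemma complex_mvt_bound f (df : R[i] -> R[i]) z (B : R) :
  (forall t : R, 0 <= t <= 1 ->
     is_derive (t%:C * z : R[i]^o) 1 (f : R[i]^o -> R[i]^o) (df (t%:C * z))) ->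
  (forall t : R, 0 <= t <= 1 -> normc (z * df (t%:C * z)) <= B) ->
  normc (f z - f 0) <= 2 * B.
Proof.
move=> fdf dfB.
rewrite (le_trans (normc_le _))// mulr_natl mulr2n lerD//.
  have := @real_mvt_bound (fun t => Re (f (t%:C * z)))
    (fun t => Re (z * df (t%:C * z))) B.
  rewrite mul1r mul0r (raddfB (@complex.Re R : Rcomplex R -> R)); apply.
    by move=> t /fdf/is_derive_ray[].
  by move=> t /dfB; apply: le_trans; exact: normc_Re.
have := @real_mvt_bound (fun t => Im (f (t%:C * z)))
  (fun t => Im (z * df (t%:C * z))) B.
rewrite mul1r mul0r (raddfB (@complex.Im R : Rcomplex R -> R)); apply.
  by move=> t /fdf/is_derive_ray[].
by move=> t /dfB; apply: le_trans; exact: normc_Im.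
Qed.

End complex_derivative.

(** * Principal powers *)

Section complex_power.
Variable R : realType.
Implicit Types (v w : R[i]) (s t x : R).

Definition cexp v : R[i] :=
  (expR (Re v) * cos (Im v)) +i* (expR (Re v) * sin (Im v)).

Definition clog w : R[i] := ln (normc w) +i* carg w.

Lemma complex_ext v w : Re v = Re w -> Im v = Im w -> v = w.
Proof. by case: v => a b; case: w => c d /= -> ->. Qed.

Lemma ReM v w : Re (v * w) = Re v * Re w - Im v * Im w.
Proof. by case: v => a b; case: w. Qed.

Lemma ImM v w : Im (v * w) = Re v * Im w + Im v * Re w.
Proof. by case: v => a b; case: w. Qed.

Lemma ReD v w : Re (v + w) = Re v + Re w.
Proof. by case: v => a b; case: w. Qed.

Lemma ImD v w : Im (v + w) = Im v + Im w.
Proof. by case: v => a b; case: w. Qed.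

Lemma normcE w : normc w = Num.sqrt (Re w ^+ 2 + Im w ^+ 2).
Proof. by case: w. Qed.

Lemma sqr_normcE w : normc w ^+ 2 = Re w ^+ 2 + Im w ^+ 2.
Proof. by rewrite normcE sqr_sqrtr// addr_ge0// sqr_ge0. Qed.

Lemma normc_cis x t : 0 <= x -> normc ((x * cos t) +i* (x * sin t)) = x.
Proof.
move=> x0; rewrite normcE/= !exprMn -mulrDr cos2Dsin2 mulr1.
by rewrite sqrtr_sqr ger0_norm.
Qed.

Lemma Re_gt0_neq0 w : 0 < Re w -> w != 0.
Proof. by move=> w0; apply/eqP => w00; rewrite w00 ltxx in w0. Qed.

Lemma cexpD v w : cexp (v + w) = cexp v * cexp w.
Proof.
apply: complex_ext; rewrite ?ReM ?ImM /= ReD ImD expRD ?cosD ?sinD; ring.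
Qed.

Lemma cexp0 : cexp 0 = 1.
Proof. by rewrite /cexp/= expR0 cos0 sin0 mulr1 mulr0. Qed.

Lemma carg_bounds w : w != 0 -> -1 <= Re w / normc w <= 1.
Proof.
move=> w0; rewrite -ler_norml normrM normfV (ger0_norm (normc_ge0 w)).
by rewrite ler_pdivrMr ?normc_gt0// mul1r normc_Re.
Qed.

Lemma cos_carg w : w != 0 -> cos (carg w) = Re w / normc w.
Proof.
move=> w0; rewrite /carg; set b := Re w / _.
have bb : b \in `[(-1), 1] by rewrite in_itv/= carg_bounds.
by case: ifP => _; rewrite ?cosN acosK.
Qed.

Lemma sin_carg w : w != 0 -> sin (carg w) = Im w / normc w.
Proof.
move=> w0; have n0 : 0 < normc w by rewrite normc_gt0.
have -> : Im w / normc w = (if 0 <= Im w then 1 else -1) *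
    Num.sqrt (1 - (Re w / normc w) ^+ 2).
  have -> : 1 - (Re w / normc w) ^+ 2 = (Im w / normc w) ^+ 2.
    rewrite !exprMn exprVn sqr_normcE; field.
    by rewrite -sqr_normcE expf_neq0// gt_eqF.
  rewrite sqrtr_sqr normrM normfV (gtr0_norm n0).
  case: ifPn => [i0|]; first by rewrite ger0_norm// mul1r.
  by rewrite -ltNge => i0; rewrite ltr0_norm// mulN1r mulNr opprK.
rewrite /carg; case: ifPn => _; rewrite ?sinN sin_acos ?carg_bounds ?mul1r//.
by rewrite mulN1r.
Qed.

Lemma cexp_clog w : w != 0 -> cexp (clog w) = w.
Proof.
move=> w0; have n0 : 0 < normc w by rewrite normc_gt0.
apply: complex_ext; rewrite /= lnK ?posrE// ?cos_carg ?sin_carg//.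
  by rewrite mulrC divfK// gt_eqF.
by rewrite mulrC divfK// gt_eqF.
Qed.

Lemma carg_cis x t : 0 < x -> - pi < t <= pi ->
  carg ((x * cos t) +i* (x * sin t)) = t.
Proof.
move=> x0 /andP[pt tp]; rewrite /carg normc_cis ?(ltW x0)//= mulrAC divff ?gt_eqF//.
rewrite mul1r pmulr_rge0//; have [t0|t0] := leP 0 t.
  by rewrite sin_ge0_pi ?t0// cosK// in_itv/= t0.
rewrite leNgt; have -> : sin t < 0.
  by rewrite -oppr_gt0 -sinN sin_gt0_pi// oppr_gt0 t0/= ltrNl.
by rewrite cosKN ?opprK// !ltW.
Qed.

Lemma clog_cexp v : - pi < Im v <= pi -> clog (cexp v) = v.
Proof.
move=> vpi; apply: complex_ext => /=; last by rewrite carg_cis ?expR_gt0.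
by rewrite normc_cis ?expR_ge0// expRK.
Qed.

Lemma cpowE w s : w != 0 -> cpow w s = cexp (s%:C * clog w).
Proof.
move=> w0; rewrite /cpow /cexp ReM ImM/= !mul0r subr0 addr0 /powR.
by rewrite normc_eq0 (negbTE w0).
Qed.

Lemma normc_cpow w s : normc (cpow w s) = normc w `^ s.
Proof. by rewrite normc_cis// powR_ge0. Qed.

Lemma cpow_neq0 w s : w != 0 -> cpow w s != 0.
Proof. by move=> w0; rewrite -normc_gt0 normc_cpow powR_gt0// normc_gt0. Qed.

Lemma cpowD w s t : w != 0 -> cpow w (s + t) = cpow w s * cpow w t.
Proof. by move=> w0; rewrite !cpowE// -cexpD rmorphD mulrDl. Qed.

Lemma cpow0 w : w != 0 -> cpow w 0 = 1.
Proof. by move=> w0; rewrite cpowE// mul0r cexp0. Qed.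

Lemma cpow1 w : w != 0 -> cpow w 1 = w.
Proof. by move=> w0; rewrite cpowE// mul1r cexp_clog. Qed.

Lemma cpowN w s : w != 0 -> cpow w (- s) = (cpow w s)^-1.
Proof.
move=> w0; apply: (mulfI (cpow_neq0 s w0)).
by rewrite -cpowD// subrr cpow0// divff// cpow_neq0.
Qed.

Lemma cpowX w s n : w != 0 -> cpow w s ^+ n = cpow w (n%:R * s).
Proof.
move=> w0; elim: n => [|n IH]; first by rewrite mul0r cpow0.
by rewrite exprS IH -cpowD// -nat1r mulrDl mul1r.
Qed.

(** The slope of [acos] is unbounded at 1, so the estimates of the argument near w = 1 go through
    [atan]. *)
Lemma cargE w : 0 < Re w -> carg w = atan (Im w / Re w).
Proof.
case: w => a b /= a0; set t := b / a.
have cE : normc (a +i* b) * cos (atan t) = a.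
  rewrite cos_atan normcE/=.
  have -> : a ^+ 2 + b ^+ 2 = a ^+ 2 * (1 + t ^+ 2).
    by rewrite /t; field; rewrite gt_eqF.
  rewrite sqrtrM ?sqr_ge0// sqrtr_sqr gtr0_norm// mulfK// sqrtr_eq0 -ltNge.
  by rewrite ltr_wpDr// sqr_ge0.
have c0 : 0 < cos (atan t) by rewrite cos_atan invr_gt0 sqrtr_gt0 ltr_wpDr// sqr_ge0.
have sE : normc (a +i* b) * sin (atan t) = b.
  rewrite -[sin _](@divfK _ (cos (atan t))) ?gt_eqF//.
  by rewrite -[sin _ / _]/(tan (atan t)) atanK mulrCA cE divfK// gt_eqF.
rewrite -[X in carg (X +i* _)]cE -[X in carg (_ +i* X)]sE carg_cis//.
  by rewrite normc_gt0 Re_gt0_neq0.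
have pi0 := pi_gt0 R; have := atan_gtNpi2 t; have := atan_ltpi2 t; lra.
Qed.

Lemma carg_Re_gt0 w : 0 < Re w -> - (pi / 2) < carg w < pi / 2.
Proof. by move=> w0; rewrite cargE// atan_gtNpi2 atan_ltpi2. Qed.

(** In the right half-plane both arguments lie in ]-pi/2, pi/2[, so their sum stays in the principal
    range. This is the source of the hypotheses on [Re] further on. *)
Lemma clogM v w : 0 < Re v -> 0 < Re w -> clog (v * w) = clog v + clog w.
Proof.
move=> v0 w0; rewrite -{1}(cexp_clog (Re_gt0_neq0 v0)).
rewrite -{1}(cexp_clog (Re_gt0_neq0 w0)) -cexpD clog_cexp// ImD/=.
have := carg_Re_gt0 v0; have := carg_Re_gt0 w0; lra.
Qed.

Lemma cpowM v w s : 0 < Re v -> 0 < Re w ->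
  cpow (v * w) s = cpow v s * cpow w s.
Proof.
move=> v0 w0; have vn0 := Re_gt0_neq0 v0; have wn0 := Re_gt0_neq0 w0.
by rewrite !cpowE ?mulf_neq0// clogM// mulrDr cexpD.
Qed.

Lemma cpow_real x s : 0 < x -> cpow x%:C s = (x `^ s)%:C.
Proof.
move=> x0; rewrite /cpow normc_real gtr0_norm// cargE//= mul0r atan0 mulr0.
by rewrite cos0 sin0 mulr0 mulr1.
Qed.

Lemma Re_inv_gt0 w : 0 < Re w -> 0 < Re w^-1.
Proof.
move=> w0; have n0 : 0 < normc w by rewrite normc_gt0 Re_gt0_neq0.
by case: w w0 n0 => a b /= a0; rewrite normcE/= sqrtr_gt0 => n0; rewrite divr_gt0.
Qed.

Lemma cpowV w s : 0 < Re w -> cpow w^-1 s = cpow w (- s).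
Proof.
move=> w0; have n0 := Re_gt0_neq0 w0; rewrite cpowN//.
apply: (mulfI (cpow_neq0 s n0)); rewrite -cpowM ?Re_inv_gt0//.
rewrite !divff// ?cpow_neq0// -[1 in LHS](rmorph1 (real_complex R)).
by rewrite cpow_real// powR1.
Qed.

End complex_power.

(** * Derivative of the principal powers *)

Section complex_power_derivative.
Variable R : realType.
Implicit Types (v w u : R[i]) (s x y : R).

(** The parametrization t * y with t in [0, 1] treats both signs of y at once. *)
Lemma mvt_bound0 (f df : R -> R) y (B : R) :
  (forall x, is_derive x 1 f (df x)) ->
  (forall x, `|x| <= `|y| -> `|df x| <= B) -> `|f y - f 0| <= B * `|y|.
Proof.
move=> fdf dfB.
have := @real_mvt_bound R (fun t => f (t * y)) (fun t => df (t * y) * y) (B * `|y|).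
rewrite mul1r mul0r; apply.
- move=> t _; have Hy : is_derive t 1 (fun t : R => t * y) y.
    apply: is_derive_eq (is_deriveM (is_derive_id _ _) (is_derive_cst _ _ _)) _.
    by rewrite scaler0 add0r [y *: _]mulr1.
  have := @is_derive1_comp R f (fun t : R => t * y) t (df (t * y)) y (fdf _) Hy.
  by [].
- move=> t /andP[t0 t1]; rewrite normrM ler_wpM2r// dfB// normrM.
  by rewrite ger0_norm// ler_piMl.
Qed.

Lemma norm_sin_le y : `|sin y| <= `|y|.
Proof.
have := @mvt_bound0 sin cos y 1; rewrite sin0 subr0 mul1r; apply => x _.
exact: cos_max.
Qed.

Lemma norm_cosB1_le y : `|cos y - 1| <= `|y| ^+ 2.
Proof.
have := @mvt_bound0 cos (fun x => - sin x) y `|y|; rewrite cos0 -expr2; apply => x xy.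
by rewrite normrN (le_trans (norm_sin_le _)).
Qed.

Lemma norm_sinB_le y : `|sin y - y| <= `|y| ^+ 3.
Proof.
have := @mvt_bound0 (fun x => sin x - x) (fun x => cos x - 1) y (`|y| ^+ 2).
rewrite sin0 !subr0 -exprSr; apply => x.
move=> xy; rewrite (le_trans (norm_cosB1_le _))// lerXn2r//.
Qed.

Lemma norm_expRB1_le x : `|x| <= 1 -> `|expR x - 1| <= expR 1 * `|x|.
Proof.
move=> x1; have := @mvt_bound0 expR expR x (expR 1); rewrite expR0; apply => t tx.
by rewrite ger0_norm ?expR_ge0// ler_expR (le_trans (ler_norm _))// (le_trans tx).
Qed.

Lemma norm_expRB1B_le x : `|x| <= 1 -> `|expR x - 1 - x| <= expR 1 * `|x| ^+ 2.
Proof.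
move=> x1; have := @mvt_bound0 (fun x => expR x - x) (fun x => expR x - 1) x
  (expR 1 * `|x|).
rewrite expR0 subr0 -mulrA -expr2 addrAC; apply => t.
move=> tx; rewrite (le_trans (norm_expRB1_le _)) ?(le_trans tx)//.
by rewrite ler_wpM2l ?expR_ge0.
Qed.

Lemma norm_atan_le x : `|atan x| <= `|x|.
Proof.
have := @mvt_bound0 atan (fun x => (1 + x ^+ 2)^-1) x 1.
rewrite atan0 subr0 mul1r; apply => t _.
have t1 : 1 <= 1 + t ^+ 2 by rewrite lerDl sqr_ge0.
by rewrite ger0_norm ?invr_ge0 ?(le_trans ler01)// invf_le1// (lt_le_trans ltr01).
Qed.

Lemma cexp_taylor v : normc v <= 1 ->
  normc (cexp v - 1 - v) <= (3 * expR 1 + 1) * normc v ^+ 2.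
Proof.
move=> v1; rewrite (le_trans (normc_le _))//.
have E0 := expR_gt0 (1 : R); set E := expR 1 in E0 *; set n := normc v in v1 *.
have n0 : 0 <= n := normc_ge0 v.
have xn : `|Re v| <= n := normc_Re v.
have yn : `|Im v| <= n := normc_Im v.
have -> : Re (cexp v - 1 - v) =
    (expR (Re v) - 1 - Re v) + expR (Re v) * (cos (Im v) - 1).
  by case: (v) => x y /=; ring.
have -> : Im (cexp v - 1 - v) =
    (expR (Re v) - 1) * sin (Im v) + (sin (Im v) - Im v).
  by case: (v) => x y /=; ring.
have x1 := le_trans xn v1.
have X2 : `|Re v| ^+ 2 <= n ^+ 2 by rewrite lerXn2r.
have Y2 : `|Im v| ^+ 2 <= n ^+ 2 by rewrite lerXn2r.
have h1 : `|expR (Re v) - 1 - Re v| <= E * n ^+ 2.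
  by rewrite (le_trans (norm_expRB1B_le _))// ler_wpM2l// ltW.
have h2 : `|expR (Re v) * (cos (Im v) - 1)| <= E * n ^+ 2.
  rewrite normrM ler_pM//.
    by rewrite ger0_norm ?expR_ge0// ler_expR (le_trans (ler_norm _)).
  exact: le_trans (norm_cosB1_le _) _.
have h3 : `|(expR (Re v) - 1) * sin (Im v)| <= E * n ^+ 2.
  rewrite normrM expr2 mulrA ler_pM//.
    by rewrite (le_trans (norm_expRB1_le _))// ler_wpM2l// ltW.
  exact: le_trans (norm_sin_le _) _.
have h4 : `|sin (Im v) - Im v| <= n ^+ 2.
  rewrite (le_trans (norm_sinB_le _))// exprS (le_trans _ Y2)//.
  by rewrite ler_piMl ?sqr_ge0// (le_trans yn).
rewrite (le_trans (lerD (ler_normD _ _) (ler_normD _ _)))//; lra.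
Qed.

Lemma clog1D_le u : normc u <= 1 / 2 -> normc (clog (1 + u)) <= 4 * normc u.
Proof.
move=> u2; set n := normc u in u2 *.
have n0 : 0 <= n := normc_ge0 u.
have xn : `|Re u| <= n := normc_Re u.
have yn : `|Im u| <= n := normc_Im u.
have rE : Re (1 + u) = 1 + Re u by rewrite ReD.
have iE : Im (1 + u) = Im u by rewrite ImD/= add0r.
have r2 : 1 / 2 <= Re (1 + u) by rewrite rE; move: xn; rewrite ler_norml; lra.
have r0 : 0 < Re (1 + u) by rewrite (lt_le_trans _ r2).
have m0 : 0 < normc (1 + u) by rewrite normc_gt0 Re_gt0_neq0.
have m1 : normc (1 + u) <= 1 + n by rewrite (le_trans (normcD _ _))// normc1.
have m2 : 1 - n <= normc (1 + u) by have := lerB_normc 1 u; rewrite normc1.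
have aE : `|carg (1 + u)| <= 2 * n.
  rewrite cargE// (le_trans (norm_atan_le _))// iE normrM normfV (gtr0_norm r0).
  rewrite ler_pdivrMr// (le_trans yn)//.
  have : n * (1 / 2) <= n * Re (1 + u) by rewrite ler_wpM2l.
  lra.
have lE : `|ln (normc (1 + u))| <= 2 * n.
  have lnB1 x : 0 < x -> ln x <= x - 1.
    by move=> x0; rewrite -[x in ln x](subrKC 1) le_ln1Dx// ltrBDr addNr.
  rewrite ler_norml; apply/andP; split; last by rewrite (le_trans (lnB1 _ m0))//; lra.
  rewrite lerNl -lnV ?posrE// (le_trans (lnB1 _ _)) ?invr_gt0//.
  rewrite lerBlDr -div1r ler_pdivrMr//.
  have : n * (1 / 2) <= n * normc (1 + u) by rewrite ler_wpM2l//; lra.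
  lra.
rewrite (le_trans (normc_le _))//=; lra.
Qed.

(** With L = log (1 + u), the power is exp (s L), and u - L = exp L - 1 - L is already quadratic
    because |L| <= 4 |u|. Thus the expansion of the exponential, used twice, also serves for the
    logarithm. *)
Lemma cpow1D_taylor s : exists C dl : R, [/\ 0 <= C, 0 < dl & forall u, normc u < dl ->
  normc (cpow (1 + u) s - 1 - u * s%:C) <= C * normc u ^+ 2].
Proof.
have E0 := expR_gt0 (1 : R); set K := 3 * expR 1 + 1 : R.
have K0 : 0 <= K by rewrite /K; lra.
(* The radius ensures |L| <= 1 and |s L| <= 1, as [cexp_taylor] requires; 16 is the square of the
   constant in |L| <= 4 |u|. *)
exists (16 * K * (`|s| ^+ 2 + `|s|)), (1 / (4 * (`|s| + 1))); split.
- by rewrite !mulr_ge0// addr_ge0.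
- by rewrite divr_gt0// mulr_gt0// ltr_wpDl.
move=> u; rewrite ltr_pdivlMr; last by rewrite mulr_gt0// ltr_wpDl.
set n := normc u => ns; have n0 : 0 <= n := normc_ge0 u.
have s0 : 0 <= `|s| by [].
have ns0 : 0 <= n * `|s| by rewrite mulr_ge0.
have u0 : 1 + u != 0.
  rewrite -normc_gt0 (lt_le_trans _ (lerB_normc _ _))// normc1 -/n; lra.
have L4 : normc (clog (1 + u)) <= 4 * n by apply: clog1D_le; rewrite -/n; lra.
set L := clog (1 + u) in L4 *.
have L0 := normc_ge0 L.
have L16 : normc L ^+ 2 <= 16 * n ^+ 2.
  by rewrite (_ : 16 * n ^+ 2 = (4 * n) ^+ 2) ?lerXn2r ?nnegrE//; [lra|ring].
have uL : normc (u - L) <= K * (16 * n ^+ 2).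
  have -> : u - L = cexp L - 1 - L by rewrite /L cexp_clog//; ring.
  rewrite (le_trans (cexp_taylor _))//; first lra.
  by rewrite ler_wpM2l.
have sLn : normc (s%:C * L) = `|s| * normc L by rewrite normcM normc_real.
have sL : normc (cexp (s%:C * L) - 1 - s%:C * L) <= K * (`|s| ^+ 2 * (16 * n ^+ 2)).
  rewrite (le_trans (cexp_taylor _))//.
    rewrite sLn; have : `|s| * normc L <= `|s| * (4 * n) by rewrite ler_wpM2l.
    lra.
  by rewrite ler_wpM2l// sLn exprMn ler_wpM2l// sqr_ge0.
rewrite cpowE// -/L.
have -> : cexp (s%:C * L) - 1 - u * s%:C =
  (cexp (s%:C * L) - 1 - s%:C * L) - s%:C * (u - L) by ring.
rewrite (le_trans (normcB _ _))// normcM normc_real.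
have : `|s| * normc (u - L) <= `|s| * (K * (16 * n ^+ 2)) by rewrite ler_wpM2l.
lra.
Qed.

(** Writing w + h = w (1 + h / w) moves the expansion to the point 1; the bound |h / w| < 1/2 keeps
    1 + h / w in the half-plane where powers are multiplicative. *)
Lemma is_derive_cpow w s : 0 < Re w ->
  is_derive (w : R[i]^o) 1 ((fun w => cpow w s) : R[i]^o -> R[i]^o)
    (s%:C * cpow w (s - 1)).
Proof.
move=> w0; have wn0 := Re_gt0_neq0 w0.
have n0 : 0 < normc w by rewrite normc_gt0.
have [C [dl [C0 dl0 H]]] := cpow1D_taylor s.
apply: (@is_deriveC_quadratic _ _ _ _ (normc w `^ s * C / normc w ^+ 2)
  (normc w * Num.min dl (1/2))).
  by rewrite mulr_gt0// lt_min dl0/= divr_gt0.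
move=> h; rewrite mulrC -ltr_pdivrMr// -normcV -normcM lt_min => /andP[hdl h2].
have r0 : 0 < Re (1 + h / w).
  rewrite ReD/=; have := normc_Re (h / w); rewrite ler_norml; lra.
have -> : w + h = w * (1 + h / w) by rewrite mulrDr mulr1 mulrCA divff// mulr1.
rewrite cpowM//; set u := h / w in hdl h2 r0 *.
have hE : h = u * w by rewrite /u divfK.
have -> : cpow w s * cpow (1 + u) s - cpow w s - h * (s%:C * cpow w (s - 1)) =
    cpow w s * (cpow (1 + u) s - 1 - u * s%:C).
  have -> : cpow w s = w * cpow w (s - 1).
    by rewrite -{2}(cpow1 wn0) -cpowD// addrC subrK.
  rewrite hE; ring.
rewrite normcM normc_cpow (le_trans (ler_wpM2l _ (H _ hdl))) ?powR_ge0//.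
rewrite [X in _ <= X](_ : _ = normc w `^ s * (C * normc u ^+ 2))//.
by rewrite hE normcM; field; rewrite gt_eqF.
Qed.

End complex_power_derivative.

(** * Lagrange inversion *)

Section generalized_binomial.
Variable R : realType.
Implicit Types (a b p : R) (y z : R[i]).

Lemma gbinom0 a : gbinom a 0 = 1.
Proof. by rewrite /gbinom big_ord0 fact0 divr1. Qed.

Lemma gbinomS a k : k.+1%:R * gbinom a k.+1 = (a - k%:R) * gbinom a k.
Proof.
have k0 : k.+1%:R != 0 :> R by rewrite pnatr_eq0.
have f0 : k`!%:R != 0 :> R by rewrite pnatr_eq0 -lt0n fact_gt0.
rewrite /gbinom big_ord_recr/= factS natrM invfM mulrCA [k.+1%:R * _]mulrA.
by rewrite divff// mul1r mulrAC mulrC.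
Qed.

(** The recursion in k has |a - k| <= A + k + 1, which is the growth of C(A + k, k), one entry of a
    row of Pascal's triangle with sum 2^(A + k). *)
Lemma gbinom_bound a A k : `|a| <= A%:R -> `|gbinom a k| <= 2 ^+ (A + k).
Proof.
move=> aA; have : `|gbinom a k| <= 'C(A + k, k)%:R.
  elim: k => [|k IH]; first by rewrite gbinom0 normr1 bin0.
  rewrite -(ler_pM2l (_ : 0 < k.+1%:R :> R)) ?ltr0n//.
  rewrite -[leLHS](_ : `|k.+1%:R * gbinom a k.+1| = _); last first.
    by rewrite normrM normr_nat.
  rewrite gbinomS normrM -natrM addnS -mul_bin_diag natrM ler_pM//.
  rewrite (le_trans (ler_normB _ _))// normr_nat -nat1r natrD.
  by rewrite addrC ler_wpDl// addrC lerD2r.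
move=> /le_trans -> //; rewrite -natrX ler_nat.
have := Pascal 1 1 (A + k); rewrite addn1 => ->.
under eq_bigr do rewrite !exp1n !muln1.
have kA : (k < (A + k).+1)%N by rewrite ltnS leq_addl.
by rewrite (bigD1 (Ordinal kA))//= leq_addr.
Qed.

(** The last linear factor is split: its constant part falls under the induction on m, and its part
    in n is absorbed by n C(N + 1, n) = (N + 1) C(N, n - 1). The shift of n then turns b i into a +
    b i, which is why b is arbitrary. *)
Lemma alternating_binomial_product N m a (b : nat -> R) : (m <= N)%N ->
  \sum_(n < N.+1) (-1) ^+ n * 'C(N, n)%:R * \prod_(i < m) (a * n%:R + b i) =
  if m == N then (-1) ^+ N * N`!%:R * a ^+ N else 0.
Proof.
elim: N m b => [|N IHN] m b.
  rewrite leqn0 => /eqP ->; rewrite big_ord1 big_ord0/= bin0 !expr0 fact0.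
  by rewrite !mulr1.
elim: m => [_|m IHm mN].
  under eq_bigr do rewrite big_ord0 mulr1 mulr_natr.
  have := exprDn (1 : R) (-1) N.+1; rewrite subrr expr0n/= => /esym H.
  by rewrite -[RHS]H; apply: eq_bigr => i _; rewrite expr1n mul1r.
rewrite eqSS.
transitivity (b m * (\sum_(n < N.+2) (-1) ^+ n * 'C(N.+1, n)%:R *
      \prod_(i < m) (a * n%:R + b i)) +
    a * \sum_(n < N.+2) (-1) ^+ n * (n%:R * 'C(N.+1, n)%:R) *
      \prod_(i < m) (a * n%:R + b i)).
  rewrite !mulr_sumr -big_split/=; apply: eq_bigr => n _.
  rewrite big_ord_recr/=; ring.
rewrite IHm 1?ltnW// ltn_eqF// mulr0 add0r big_ord_recl/= mul0r mulr0 mul0r add0r.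
transitivity (a * (- N.+1%:R * (\sum_(n < N.+1) (-1) ^+ n * 'C(N, n)%:R *
    \prod_(i < m) (a * n%:R + (a + b i))))).
  congr (_ * _); rewrite mulr_sumr; apply: eq_bigr => n _.
  rewrite -natrM /bump/= add1n -mul_bin_diag natrM/=.
  have -> : \prod_(i < m) (a * n.+1%:R + b i) = \prod_(i < m) (a * n%:R + (a + b i)).
    by apply: eq_bigr => i _; rewrite -nat1r; ring.
  by move: (\prod_(i < m) _) => X; rewrite exprS; ring.
rewrite (IHN m (fun i => a + b i))//; case: eqP => _; last by rewrite !mulr0.
by rewrite factS natrM !exprS; ring.
Qed.

Lemma gbinom_convolution p N :
  \sum_(n < N.+1) gbinom (n%:R * p - 1) n * gbinom (- (n%:R * p)) (N - n) =
  (p - 1) ^+ N.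
Proof.
have N0 : N`!%:R != 0 :> R by rewrite pnatr_eq0 -lt0n fact_gt0.
apply: (mulfI N0).
(* The n-th term is (-1)^(N-n) C(N, n) P(n) / N! where
   P(x) = \prod_(i < N) ((p - 1) x + i). *)
have := @alternating_binomial_product N N (p - 1) (fun i => i%:R) (leqnn _).
rewrite eqxx => /(congr1 (fun x => (-1) ^+ N * x)).
rewrite -mulrA mulrA -exprMn mulrNN mulr1 expr1n mul1r => <-.
rewrite !mulr_sumr; apply: eq_bigr => -[n /= nN] _; rewrite ltnS in nN.
have -> : \prod_(i < N) ((p - 1) * n%:R + i%:R) =
    (\prod_(i < n) (n%:R * p - 1 - i%:R)) *
    ((-1) ^+ (N - n) * \prod_(i < N - n) (- (n%:R * p) - i%:R)).
  (* The first n factors, read backwards, form the numerator of [gbinom (n p - 1) n]. The others are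
     n p + j for j < N - n, up to sign the numerator of [gbinom (- n p) (N - n)]. *)
  transitivity (\prod_(i < n + (N - n)) ((p - 1) * n%:R + i%:R)).
    by rewrite subnKC.
  rewrite big_split_ord/=; congr (_ * _).
    rewrite (reindex_inj rev_ord_inj)/=; apply: eq_bigr => i _.
    by rewrite natrB// -natr1; ring.
  rewrite -[X in (-1) ^+ X](card_ord (N - n)) -prodrN; apply: eq_bigr => i _.
  by rewrite natrD; ring.
rewrite -(bin_fact nN) !natrM /gbinom.
have n0 : n`!%:R != 0 :> R by rewrite pnatr_eq0 -lt0n fact_gt0.
have Nn0 : (N - n)`!%:R != 0 :> R by rewrite pnatr_eq0 -lt0n fact_gt0.
have sgn : (-1) ^+ N * (-1) ^+ n * (-1) ^+ (N - n) = 1 :> R.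
  by rewrite -mulrA -exprD subnKC// -exprMn mulrNN mulr1 expr1n.
set X := \prod_(i < n) _; set Y := \prod_(i < N - n) _.
transitivity (('C(N, n)%:R * X * Y) *
  ((-1) ^+ N * (-1) ^+ n * (-1) ^+ (N - n))); last by ring.
by rewrite sgn; field; rewrite n0 Nn0.
Qed.

End generalized_binomial.

(** * Limits of partial sums with geometric error *)

Section geometric_approximation.
Variable R : realType.
Implicit Types (T : nat -> R[i]) (L q w : R[i]).

(** One fixed rate, reached by all the series involved once their variable is small, makes the
    notion stable under linear combinations and index shifts. *)
Definition geo_approx T L := exists C : R, forall N, normc (T N - L) <= C / 2 ^+ N.

Lemma geo_approx_unique T L L' : geo_approx T L -> geo_approx T L' -> L = L'.
Proof.
move=> [C TC] [C' TC']; apply/eqP; rewrite -subr_eq0 -normc_eq0 eq_le normc_ge0 andbT.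
rewrite leNgt; apply/negP => d0.
have CC N : normc (L - L') * N%:R <= C + C'.
  rewrite (@le_trans _ _ (normc (L - L') * 2 ^+ N))//.
    by rewrite ler_wpM2l ?normc_ge0// -natrX ler_nat ltnW// ltn_expl.
  rewrite -ler_pdivlMr ?exprn_gt0// mulrDl.
  have -> : L - L' = (T N - L') - (T N - L) by ring.
  by rewrite (le_trans (normcB _ _))// addrC lerD.
have := CC (Num.truncn ((C + C') / normc (L - L'))).+1.
by rewrite leNgt mulrC -ltr_pdivrMr// truncnS_gt.
Qed.

Lemma geo_approx_cst L : geo_approx (fun=> L) L.
Proof. by exists 0 => N; rewrite subrr normc0 mul0r. Qed.

Lemma geo_approxD T T' L L' : geo_approx T L -> geo_approx T' L' ->
  geo_approx (fun N => T N + T' N) (L + L').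
Proof.
move=> [C TC] [C' TC']; exists (C + C') => N; rewrite mulrDl opprD addrACA.
by rewrite (le_trans (normcD _ _))// lerD.
Qed.

Lemma geo_approxZ q T L : geo_approx T L -> geo_approx (fun N => q * T N) (q * L).
Proof.
move=> [C TC]; exists (normc q * C) => N.
by rewrite -mulrBr normcM -mulrA ler_wpM2l// normc_ge0.
Qed.

Lemma geo_approxB T T' L L' : geo_approx T L -> geo_approx T' L' ->
  geo_approx (fun N => T N - T' N) (L - L').
Proof.
move=> TL /(geo_approxZ (-1)) TL'; have := geo_approxD TL TL'.
by rewrite mulN1r; under eq_fun do rewrite mulN1r.
Qed.

(** A shift costs a factor 2 in the constant. It is used to drop the empty sum at N = 0, where a
    correction of the constant term would not match. *)
Lemma geo_approxS T L : geo_approx T L <-> geo_approx (fun N => T N.+1) L.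
Proof.
split=> [[C TC]|[C TC]].
  exists (C / 2) => N; rewrite (le_trans (TC _))// exprS invfM mulrA//.
exists (Num.max (2 * C) (normc (T 0%N - L))) => -[|N].
  by rewrite expr0 divr1 le_max lexx orbT.
rewrite (le_trans (TC N))// exprS invfM mulrA ler_wpM2r ?invr_ge0 ?exprn_ge0//.
by rewrite ler_pdivlMr// le_max mulrC lexx.
Qed.

Lemma eq_geo_approx T T' L L' : T =1 T' -> L = L' -> geo_approx T L -> geo_approx T' L'.
Proof. by move=> /funext -> ->. Qed.

Lemma geo_approx_geometric q : normc q <= 1 / 2 ->
  geo_approx (fun N => \sum_(n < N) q ^+ n) (1 - q)^-1.
Proof.
move=> q2; have q1 : 1 / 2 <= normc (1 - q).
  have := lerB_normc 1 (- q); rewrite normc1 normc_opp; lra.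
have q0 : 1 - q != 0 by rewrite -normc_gt0 (lt_le_trans _ q1).
exists 2 => N.
have -> : \sum_(n < N) q ^+ n - (1 - q)^-1 = - (q ^+ N / (1 - q)).
  have -> : \sum_(n < N) q ^+ n = (1 - q ^+ N) / (1 - q).
    apply: (mulfI q0); rewrite mulrCA divff// mulr1.
    by rewrite -opprB mulNr -subrX1 opprB.
  by rewrite mulrBl mul1r addrAC subrr add0r.
rewrite normc_opp normcM normcV normcX mulrC ler_pM ?invr_ge0 ?exprn_ge0 ?normc_ge0//.
  by rewrite invf_ple ?posrE ?(lt_le_trans _ q1)//; lra.
by rewrite -exprVn lerXn2r ?nnegrE ?normc_ge0//; lra.
Qed.

End geometric_approximation.

(** * The moment series of nu(p, -1) *)

Section lagrange_series.
Variable R : realType.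
Implicit Types (a p : R) (y z w : R[i]).

Definition binomial_sum a j y : R[i] := \sum_(k < j) (gbinom a k)%:C * y ^+ k.

Definition binomial_sum' a j y : R[i] :=
  \sum_(k < j) (gbinom a k)%:C * (k%:R * y ^+ k.-1).

(** The full series solves (1 + y) f' = a f. By (k + 1) C(a, k + 1) = (a - k) C(a, k), truncation
    leaves one boundary monomial; at j = 0 its factor j cancels the default exponent. *)
Lemma binomial_sum_ode a j y :
  (1 + y) * binomial_sum' a j y - a%:C * binomial_sum a j y =
  - (j%:R * (gbinom a j)%:C * y ^+ j.-1).
Proof.
rewrite /binomial_sum /binomial_sum'; elim: j => [|j IH].
  by rewrite !big_ord0 !mulr0 !mul0r subrr oppr0.
rewrite !big_ord_recr/= !mulrDr opprD addrACA IH.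
have -> : j.+1%:R * (gbinom a j.+1)%:C = (a%:C - j%:R) * (gbinom a j)%:C :> R[i].
  by rewrite -!(rmorph_nat (real_complex R)) -rmorphM gbinomS rmorphM rmorphB.
case: j {IH} => [|j]/=; rewrite ?exprS; ring.
Qed.

Lemma is_deriveC_exp z n :
  is_derive (z : R[i]^o) 1 ((fun z => z ^+ n) : R[i]^o -> R[i]^o) (n%:R * z ^+ n.-1).
Proof.
have := @is_deriveX R[i] R[i]^o id n z 1 1 (is_derive_id _ _).
rewrite exprfctE => H; apply: is_derive_eq H _.
by rewrite /GRing.scale/= mulr1.
Qed.

Lemma is_derive_binomial_sum a j y :
  is_derive (y : R[i]^o) 1 (binomial_sum a j : R[i]^o -> R[i]^o)
    (binomial_sum' a j y).
Proof.
rewrite /binomial_sum (_ : (fun y => _) =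
    \sum_(k < j) ((gbinom a k)%:C \*: (fun y : R[i]^o => y ^+ k : R[i]^o))).
  apply: is_derive_sum => k; apply: is_deriveZ; exact: is_deriveC_exp.
by apply/funext => x; rewrite fct_sumE.
Qed.

Lemma powR_bound x (s : R) A : 1 / 2 <= x <= 2 -> `|s| <= A%:R -> x `^ s <= 2 ^+ A.
Proof.
move=> /andP[x2 x2'] sA; have x0 : 0 < x by lra.
rewrite -powR_mulrn// /powR !gt_eqF// ler_expR.
have l2 : 0 <= ln 2 :> R by rewrite ln_ge0//; lra.
have lx : `|ln x| <= ln 2.
  rewrite ler_norml -lnV ?posrE// !ler_ln ?posrE ?invr_gt0//.
  by rewrite x2' -div1r x2.
by rewrite (le_trans (ler_norm _))// normrM ler_pM.
Qed.

Lemma Re_1D_gt0 y : normc y <= 1 / 2 -> 1 / 2 <= Re (1 + y).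
Proof. by move=> y2; rewrite ReD/=; have := normc_Re y; rewrite ler_norml; lra. Qed.

Lemma normc_1D y : normc y <= 1 / 2 -> 1 / 2 <= normc (1 + y) <= 2.
Proof.
move=> y2; have := normcD 1 y; have := lerB_normc 1 y; rewrite normc1; lra.
Qed.

Lemma is_derive_cpow1D y (s : R) : 0 < Re (1 + y) ->
  is_derive (y : R[i]^o) 1 ((fun y => cpow (1 + y) s) : R[i]^o -> R[i]^o)
    (s%:C * cpow (1 + y) (s - 1)).
Proof.
move=> y0; apply/is_deriveCP => e e0.
have /is_deriveCP/(_ e e0)[dl dl0 H] := is_derive_cpow s y0.
by exists dl => // h /H; rewrite addrA.
Qed.

(** The product of (1 + z)^(-a) and the partial sum equals 1 at z = 0 and varies little up to y. The
    constants are crude but purely exponential in A and j, so that A may later grow linearly with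
    the summation index: each of the two powers of 1 + z and the coefficient bound contributes a
    factor 2^A, whence 8^A. *)
Lemma binomial_taylor a A j y : `|a| <= A%:R -> normc y <= 1 / 2 ->
  normc (cpow (1 + y) a - binomial_sum a j.+1 y) <=
  4 * 8 ^+ A * (4 * normc y) ^+ j.+1.
Proof.
move=> aA y2; have /andP[n1 n2] := normc_1D y2.
have r0 z : normc z <= 1 / 2 -> 0 < Re (1 + z).
  by move=> /Re_1D_gt0; apply: lt_le_trans; rewrite divr_gt0.
have y0 : 1 + y != 0 by rewrite Re_gt0_neq0// r0.
(* By [binomial_sum_ode] the derivative of [h] reduces to a single monomial. *)
pose h z := cpow (1 + z) (- a) * binomial_sum a j.+1 z.
pose dh z := cpow (1 + z) (- a - 1) * - (j.+1%:R * (gbinom a j.+1)%:C * z ^+ j).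
have hdh z : normc z <= 1 / 2 ->
    is_derive (z : R[i]^o) 1 (h : R[i]^o -> R[i]^o) (dh z).
  move=> z2; have z0 := Re_gt0_neq0 (r0 z z2).
  apply: is_derive_eq (@is_deriveM R[i] R[i]^o _ _ _ _ _ _
    (is_derive_cpow1D (- a) (r0 z z2)) (is_derive_binomial_sum a j.+1 z)) _.
  rewrite /dh -(binomial_sum_ode a j.+1 z) /GRing.scale/=.
  have -> : cpow (1 + z) (- a) = (1 + z) * cpow (1 + z) (- a - 1).
    by rewrite -{2}(cpow1 z0) -cpowD// subrKC.
  by rewrite rmorphN; ring.
have h0 : h 0 = 1.
  rewrite /h /binomial_sum addr0 big_ord_recl big1 ?addr0; last first.
    by move=> i _; rewrite /bump/= expr0n/= mulr0.
  rewrite gbinom0 expr0 mulr1 mulr1 -[X in cpow X](rmorph1 (real_complex R)).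
  by rewrite cpow_real// powR1.
have ty (t : R) : 0 <= t <= 1 -> normc (t%:C * y) <= normc y.
  move=> /andP[t0 t1]; rewrite normcM normc_real ger0_norm//.
  by rewrite ler_piMl ?normc_ge0.
have H : normc (h y - h 0) <=
    2 * (normc y * (2 ^+ A.+1 * (2 ^+ j.+1 * 2 ^+ (A + j.+1) * normc y ^+ j))).
  apply: (@complex_mvt_bound R h dh) => t /ty ty1.
    by apply: hdh; exact: le_trans y2.
  rewrite !normcM ler_wpM2l ?normc_ge0// normc_opp !normcM normcX.
  have /normc_1D n12 := le_trans ty1 y2.
  apply: ler_pM; rewrite ?mulr_ge0 ?exprn_ge0 ?normc_ge0//.
    rewrite normc_cpow; apply: powR_bound => //.
    by rewrite -opprD normrN -natr1 (le_trans (ler_normD _ _))// normr1 lerD2r.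
  apply: ler_pM; rewrite ?mulr_ge0 ?exprn_ge0 ?normc_ge0//; last first.
    by rewrite lerXn2r// nnegrE normc_ge0.
  rewrite -(rmorph_nat (real_complex R)) !normc_real.
  apply: ler_pM => //; last exact: gbinom_bound.
  by rewrite normr_nat -natrX ler_nat ltnW// ltn_expl.
rewrite h0 in H.
have -> : cpow (1 + y) a - binomial_sum a j.+1 y = - (cpow (1 + y) a * (h y - 1)).
  rewrite mulrBr /h mulrA -cpowD// subrr cpow0// mul1r mulr1; ring.
rewrite normc_opp normcM normc_cpow.
have := ler_pM (powR_ge0 _ _) (normc_ge0 _) (powR_bound (normc_1D y2) aA) H.
move=> /le_trans; apply.
have -> : 8 = 2 * 2 * 2 :> R by ring.
have -> : 4 = 2 * 2 :> R by ring.
rewrite le_eqVlt; apply/orP; left; apply/eqP; rewrite !exprMn !exprD !exprS; ring.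
Qed.

(** Passing from N to N + 1 lengthens each truncated series by its term of order N - n, so all the
    new terms carry y^N and their coefficients add up to [gbinom_convolution]. *)
Lemma binomial_double_sum p N y :
  \sum_(n < N) (gbinom (n%:R * p - 1) n)%:C * y ^+ n *
    binomial_sum (- (n%:R * p)) (N - n) y =
  \sum_(n < N) ((p - 1)%:C * y) ^+ n.
Proof.
elim: N => [|N IH]; first by rewrite !big_ord0.
rewrite [RHS]big_ord_recr/= -{}IH big_ord_recr/= subSnn.
have -> : \sum_(n < N) (gbinom (n%:R * p - 1) n)%:C * y ^+ n *
      binomial_sum (- (n%:R * p)) (N.+1 - n) y =
    \sum_(n < N) (gbinom (n%:R * p - 1) n)%:C * y ^+ n *
      binomial_sum (- (n%:R * p)) (N - n) y +
    \sum_(n < N) (gbinom (n%:R * p - 1) n * gbinom (- (n%:R * p)) (N - n))%:C * y ^+ N.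
  rewrite -big_split/=; apply: eq_bigr => n _; rewrite subSn; last exact: ltnW.
  rewrite /binomial_sum big_ord_recr/= mulrDr; congr (_ + _).
  have -> : y ^+ N = y ^+ n * y ^+ (N - n) by rewrite -exprD subnKC// ltnW.
  move: (gbinom _ n) (gbinom _ (N - n)) => g1 g2.
  by rewrite rmorphM -!mulrA; congr (_ * _); rewrite mulrCA.
rewrite -addrA; congr (_ + _).
rewrite /binomial_sum big_ord_recl big_ord0 addr0 gbinom0 expr0 !mulr1.
rewrite exprMn -rmorphXn/= -gbinom_convolution big_ord_recr/= subnn gbinom0 mulr1.
by rewrite rmorphD/= mulrDl raddf_sum/= mulr_suml.
Qed.

(* Truncating (1 + y)^(-n p) at order N - n leaves exactly the terms of total
   degree < N in y, and every remainder is at most 8 / 4^N. *)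
Lemma lagrange_series_bound p : exists2 dl : R, 0 < dl &
  forall y N, normc y < dl ->
  normc (\sum_(n < N) (gbinom (n%:R * p - 1) n)%:C * (y * cpow (1 + y) (- p)) ^+ n -
    \sum_(n < N) ((p - 1)%:C * y) ^+ n) <= 8 / 2 ^+ N.
Proof.
pose P := (Num.truncn `|p|).+1.
have pP : `|p| <= P%:R by rewrite ltW// truncnS_gt.
have D0 : 0 < 2 * (2 * 16 ^+ P * 4) :> R by rewrite !mulr_gt0// exprn_gt0.
(* With |n p| <= n P, the coefficient contributes (2 * 2^P)^n and the remainder (8^P)^n. The radius
   brings the ratios 2 * 16^P |y| and 4 |y| below 1/4. *)
exists (1 / (2 * (2 * 16 ^+ P * 4)) / 2); first by rewrite !divr_gt0.
move=> y N; rewrite ltr_pdivlMr// ltr_pdivlMr// => yD.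
have y0 := normc_ge0 y.
have P1 : 1 <= 16 ^+ P :> R by rewrite exprn_ege1//; lra.
have yP : normc y <= normc y * 16 ^+ P by rewrite ler_peMr.
have y2 : normc y <= 1 / 2 by lra.
have y10 : 1 + y != 0.
  by rewrite -normc_gt0; have /andP[] := normc_1D y2; lra.
rewrite -binomial_double_sum -sumrB.
have term (n : 'I_N) :
    normc ((gbinom (n%:R * p - 1) n)%:C * (y * cpow (1 + y) (- p)) ^+ n -
    (gbinom (n%:R * p - 1) n)%:C * y ^+ n * binomial_sum (- (n%:R * p)) (N - n) y) <=
    8 * (1 / 4) ^+ N.
  rewrite exprMn cpowX// mulrN mulrA -mulrBr normcM.
  have -> : (N - n = (N - n.+1).+1)%N by rewrite -subSn.
  have nP : `|n%:R * p| <= (n * P)%:R.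
    by rewrite normrM normr_nat natrM ler_wpM2l.
  have nP1 : `|n%:R * p - 1| <= (n * P).+1%:R.
    by rewrite -natr1 (le_trans (ler_normB _ _))// normr1 lerD2r.
  have h1 : normc ((gbinom (n%:R * p - 1) n)%:C * y ^+ n) <=
      2 * (2 * 2 ^+ P * normc y) ^+ n.
    rewrite normcM normc_real normcX !exprMn -exprM mulrA ler_wpM2r ?exprn_ge0//.
    rewrite (le_trans (gbinom_bound _ nP1))//.
    rewrite le_eqVlt; apply/orP; left; apply/eqP.
    rewrite addSn exprS exprD [(P * n)%N]mulnC; ring.
  rewrite -normrN in nP.
  have h2 := binomial_taylor (N - n.+1) nP y2.
  rewrite (le_trans (ler_pM (normc_ge0 _) (normc_ge0 _) h1 h2))//.
  rewrite -subSn// subSS mulnC exprM.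
  have -> : (1 / 4) ^+ N = (1 / 4) ^+ n * (1 / 4) ^+ (N - n) :> R.
    by rewrite -exprD subnKC// ltnW.
  have -> : 2 * (2 * 2 ^+ P * normc y) ^+ n * (4 * (8 ^+ P) ^+ n * (4 * normc y) ^+ (N - n)) =
      8 * ((2 * 16 ^+ P * normc y) ^+ n * (4 * normc y) ^+ (N - n)).
    have -> : 16 = 2 * 8 :> R by ring.
    by move: ((4 * normc y) ^+ _) => u; rewrite !exprMn; ring.
  rewrite ler_wpM2l// ler_pM ?exprn_ge0 ?mulr_ge0 ?exprn_ge0//.
    by rewrite lerXn2r ?nnegrE ?mulr_ge0 ?exprn_ge0//; lra.
  by rewrite lerXn2r ?nnegrE ?mulr_ge0//; lra.
rewrite (le_trans (normc_sum _ _ _))//.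
rewrite (le_trans (ler_sum _ (fun n _ => term n)))//.
(* There are N terms of size 8 / 4^N, and N <= 2^N. *)
rewrite sumr_const card_ord -[_ *+ N]mulr_natr -mulrA ler_wpM2l//.
have -> : 1 / 4 = 2^-1 * 2^-1 :> R by field.
rewrite exprMn exprVn -mulrA ler_piMr ?invr_ge0 ?exprn_ge0//.
by rewrite mulrC ler_pdivrMr ?exprn_gt0// mul1r -natrX ler_nat ltnW// ltn_expl.
Qed.

Lemma lagrange_series p : exists2 dl : R, 0 < dl & forall y, normc y < dl ->
  geo_approx (fun N => \sum_(n < N) (gbinom (n%:R * p - 1) n)%:C *
    (y * cpow (1 + y) (- p)) ^+ n) (1 - (p - 1)%:C * y)^-1.
Proof.
have [dl dl0 H] := lagrange_series_bound p.
have p0 : 0 < `|p - 1| + 1 by rewrite ltr_wpDl.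
exists (Num.min dl (1 / (2 * (`|p - 1| + 1)))).
  by rewrite lt_min dl0 divr_gt0// mulr_gt0.
move=> y; rewrite lt_min ltr_pdivlMr ?mulr_gt0// => /andP[ydl y2].
have q2 : normc ((p - 1)%:C * y) <= 1 / 2.
  rewrite normcM normc_real; have := normc_ge0 y; lra.
have hT : geo_approx (fun N =>
    \sum_(n < N) (gbinom (n%:R * p - 1) n)%:C * (y * cpow (1 + y) (- p)) ^+ n -
    \sum_(n < N) ((p - 1)%:C * y) ^+ n) 0.
  by exists 8 => N; rewrite subr0 H.
have := geo_approxD hT (geo_approx_geometric q2); rewrite add0r.
by apply: eq_geo_approx => // N; rewrite subrK.
Qed.

End lagrange_series.

(** * Trigonometric integrals *)

Section trigonometric_integrals.
Variable R : realType.
Local Notation mu := (@lebesgue_measure R).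

Lemma Rintegral_FTC (F f : R -> R) (a b : R) : a < b ->
  (forall x : R, is_derive x 1 F (f x)) -> continuous f ->
  \int[mu]_(x in `[a, b]) f x = F b - F a.
Proof.
move=> ab dF cf; have cF : continuous F.
  by move=> x; apply: differentiable_continuous; apply/derivable1_diffP; case: (dF x).
rewrite /Rintegral (@continuous_FTC2 _ f F)//.
- by apply: continuous_subspaceT.
- split.
  + by move=> x _; case: (dF x).
  + exact/cvg_at_right_filter/cF.
  + exact/cvg_at_left_filter/cF.
- by move=> x _; rewrite derive1E; case: (dF x).
Qed.

Lemma continuous_integrable_itv (f : R -> R) (a b : R) : continuous f ->
  mu.-integrable `[a, b] (EFin \o f).
Proof.
move=> cf; apply: continuous_compact_integrable; first exact: segment_compact.
exact: continuous_subspaceT.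
Qed.

Lemma continuous_1Dcos_exp n : continuous (fun x : R => (1 + cos x) ^+ n).
Proof.
move=> x; apply: (@continuous_comp _ _ _ (fun x => 1 + cos x) (fun y => y ^+ n)).
  by apply: continuousD; [exact: cst_continuous|exact: continuous_cos].
exact: exprn_continuous.
Qed.

Definition wallis n : R := \int[mu]_(x in `[0, pi]) (1 + cos x) ^+ n.

Lemma wallis0 : wallis 0 = pi.
Proof.
rewrite /wallis; under eq_Rintegral do rewrite expr0.
have := @Rintegral_FTC id (fun=> 1) 0 pi (pi_gt0 R); rewrite subr0; apply.
by move=> x; exact: cst_continuous.
Qed.

(** The difference of the two sides is the integral of the derivative of sin x (1 + cos x)^n, which
    vanishes at 0 and pi. *)
Lemma wallisS n : n.+1%:R * wallis n.+1 = (2 * n%:R + 1) * wallis n.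
Proof.
have i1 k := @continuous_integrable_itv _ 0 pi (@continuous_1Dcos_exp k).
apply/eqP; rewrite -subr_eq0 /wallis -!RintegralZl//.
have iM (a : R) k : mu.-integrable `[0, pi] (EFin \o (fun x : R => a * (1 + cos x) ^+ k)).
  apply: continuous_integrable_itv => x; apply: cvgM.
    exact: cvg_cst.
  exact: continuous_1Dcos_exp.
rewrite -RintegralB//.
have dF x : is_derive (x : R) 1 (fun x => sin x * (1 + cos x) ^+ n)
    (n.+1%:R * (1 + cos x) ^+ n.+1 - (2 * n%:R + 1) * (1 + cos x) ^+ n).
  have dc : is_derive x 1 (fun x : R => 1 + cos x) (- sin x).
    apply: is_derive_eq (is_deriveD (is_derive_cst _ _ _) (is_derive_cos x)) _.
    by rewrite add0r.
  have dX := @is_deriveX _ _ (fun x : R => 1 + cos x) n x 1 _ dc.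
  rewrite exprfctE in dX.
  apply: is_derive_eq (is_deriveM (is_derive_sin x) dX) _.
  rewrite /GRing.scale/=.
  have s2 : sin x * sin x = (1 - cos x) * (1 + cos x).
    transitivity (cos x ^+ 2 + sin x ^+ 2 - cos x ^+ 2); first by ring.
    by rewrite cos2Dsin2; ring.
  case: (n) => [|m] /=.
    by rewrite !expr0 !mul0r; ring.
  have -> : m.+2%:R = m%:R + 1 + 1 :> R by rewrite -!natr1.
  have -> : m.+1%:R = m%:R + 1 :> R by rewrite -!natr1.
  transitivity (- (m%:R + 1) * (1 + cos x) ^+ m * (sin x * sin x) +
    (1 + cos x) ^+ m.+1 * cos x); first by rewrite !exprS; ring.
  by rewrite s2 !exprS; ring.
rewrite (@Rintegral_FTC _ _ 0 pi (pi_gt0 R) dF).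
  by rewrite sinpi sin0 !mul0r subrr.
move=> x; apply: cvgB; apply: cvgM; try exact: cvg_cst; exact: continuous_1Dcos_exp.
Qed.

Lemma poisson_denominator (r c : R) : 0 <= r < 1 -> -1 <= c <= 1 ->
   0 < 1 - 2 * r * c + r ^+ 2.
Proof.
move=> /andP[r0 r1] /andP[c1 c2].
have : 0 < (1 - r) ^+ 2 by rewrite exprn_gt0// subr_gt0.
have : r * c <= r * 1 by rewrite ler_wpM2l.
nra.
Qed.

Lemma Rintegral_poisson (r : R) : 0 < r < 1 ->
  \int[mu]_(x in `[0, pi]) ((1 - cos x) / (1 - 2 * r * cos x + r ^+ 2)) = pi / (1 + r).
Proof.
move=> /andP[r0 r1].
have D0 x : 0 < 1 - 2 * r * cos x + r ^+ 2.
  by apply: poisson_denominator; rewrite ?cos_geN1 ?cos_le1// ltW.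
have d0 x : 0 < 1 - r * cos x.
  rewrite subr_gt0 (le_lt_trans _ r1)// ler_piMr ?(ltW r0)// cos_le1.
(* The denominator is (1 - r)^2 + 2 r (1 - cos x), so the integrand is (1 - k P) / (2 r) with P = (1
   - r^2) / (1 - 2 r cos x + r^2) the Poisson kernel. *)
pose k := (1 - r) / (1 + r).
(* atan (r sin x / (1 - r cos x)) is - arg (1 - r e^(ix)), which unlike
   tan (x / 2) has no singularity on [0, pi]. *)
pose F x := (x - k * (x + 2 * atan (r * sin x / (1 - r * cos x)))) / (2 * r).
have dF x : is_derive (x : R) 1 F ((1 - cos x) / (1 - 2 * r * cos x + r ^+ 2)).
  have dd : is_derive x 1 (fun x : R => 1 - r * cos x) (r * sin x).
    apply: is_derive_eq (is_deriveB (is_derive_cst _ _ _)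
      (is_deriveZ r (is_derive_cos x))) _.
    by rewrite /GRing.scale/= sub0r mulrN opprK.
  have dq : is_derive x 1 (fun x : R => r * sin x / (1 - r * cos x))
      ((r * cos x - r ^+ 2) / (1 - r * cos x) ^+ 2).
    apply: is_derive_eq (is_deriveM (is_deriveZ r (is_derive_sin x))
      (is_derive_inv _ dd)) _; first by rewrite gt_eqF.
    rewrite /GRing.scale/= /GRing.scale/=.
    transitivity ((r * cos x * (1 - r * cos x) - r ^+ 2 * (sin x ^+ 2)) /
      (1 - r * cos x) ^+ 2); first by field; rewrite gt_eqF.
    by rewrite sin2cos2; congr (_ / _); ring.
  have datan := @is_derive1_comp R atan _ x _ _ (is_derive1_atan _) dq.
  have := is_deriveZ (2 * r)^-1 (is_deriveB (is_derive_id x (1 : R)) (is_deriveZ k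
    (is_deriveD (is_derive_id x (1 : R)) (is_deriveZ 2 datan)))).
  have -> : (2 * r)^-1 \*: (id - k \*: (id + 2 \*: (atan \o
      (fun x => r * sin x / (1 - r * cos x))))) = F :> (R -> R).
    by apply/funext => t; rewrite /F [RHS]mulrC.
  move=> H; apply: is_derive_eq H _; rewrite /GRing.scale/= /k.
  have -> : 1 + (r * sin x / (1 - r * cos x)) ^+ 2 =
      (1 - 2 * r * cos x + r ^+ 2) / (1 - r * cos x) ^+ 2.
    transitivity (((1 - r * cos x) ^+ 2 + r ^+ 2 * (sin x ^+ 2)) /
      (1 - r * cos x) ^+ 2); first by field; rewrite gt_eqF.
    by rewrite sin2cos2; congr (_ / _); ring.
  by field; rewrite !gt_eqF//; lra.
rewrite (@Rintegral_FTC _ _ 0 pi (pi_gt0 R) dF).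
  rewrite /F sinpi sin0 mulr0 !mul0r atan0 /k; field; rewrite ?gt_eqF//; lra.
move=> x; apply: cvgM.
  by apply: cvgB; [exact: cvg_cst|exact: continuous_cos].
apply: cvgV; first by rewrite gt_eqF.
apply: cvgD; last exact: cvg_cst.
apply: cvgB; first exact: cvg_cst.
by apply: cvgM; [exact: cvg_cst|exact: continuous_cos].
Qed.

End trigonometric_integrals.

(** * The moment series of nu(p, 0) and central binomial coefficients *)

Section lagrange_series0.
Variable R : realType.

(** For m = n + 1, the two numerators share all factors but one: m p on the left, and m p - m = m (p
    - 1) on the right. *)
Lemma gbinom_np (p : R) n : p != 1 -> gbinom (n.+1%:R * p) n.+1 =
  p / (p - 1) * gbinom (n.+1%:R * p - 1) n.+1.
Proof.
move=> p1; have p10 : p - 1 != 0 by rewrite subr_eq0.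
have n0 : n.+1%:R != 0 :> R by rewrite pnatr_eq0.
rewrite /gbinom mulrA; congr (_ / _).
transitivity (n.+1%:R * p * \prod_(i < n) (n.+1%:R * p - 1 - i%:R)).
  rewrite big_ord_recl/= subr0; congr (_ * _); apply: eq_bigr => i _.
  by rewrite /bump/= add1n -[i.+1%:R]natr1; ring.
rewrite big_ord_recr/=; move: (\prod_(i < n) _) => Q.
have -> : n.+1%:R * p - 1 - n%:R = n.+1%:R * (p - 1) by rewrite -natr1; ring.
by field.
Qed.

(** Beyond the constant term the coefficients are p / (p - 1) times those of [lagrange_series].
    Correcting that term by -1 / (p - 1) turns p / (p - 1) * 1 / (1 - (p - 1) y) into the limit. *)
Lemma lagrange_series0 (p : R) : p != 1 -> exists2 dl : R, 0 < dl & forall y, normc y < dl ->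
  geo_approx (fun N => \sum_(n < N) (gbinom (n%:R * p + 0) n)%:C *
    (y * cpow (1 + y) (- p)) ^+ n) ((1 + y) / (1 - (p - 1)%:C * y)).
Proof.
move=> p1; have p10 : p - 1 != 0 by rewrite subr_eq0.
have [dl dl0 H] := lagrange_series p.
pose d := Num.min dl (1 / (2 * (`|p - 1| + 1))).
have P0 : 0 < `|p - 1| + 1 by rewrite ltr_wpDl.
exists d; first by rewrite lt_min dl0 divr_gt0// mulr_gt0.
move=> y; rewrite lt_min ltr_pdivlMr ?mulr_gt0// => /andP[/H ydl y2].
have q0 : 1 - (p - 1)%:C * y != 0.
  rewrite -normc_gt0 (lt_le_trans _ (lerB_normc _ _))// normc1 normc_opp normcM.
  by rewrite normc_real; have := normc_ge0 y; lra.
apply/geo_approxS.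
have /geo_approxS h1 := geo_approxZ (p / (p - 1))%:C ydl.
have h2 := geo_approxD h1 (geo_approx_cst (- (p - 1)^-1%:C)).
apply: eq_geo_approx h2 => [N|].
  rewrite !big_ord_recl/= !gbinom0 !expr0 !mulr1 mulrDr mulr1 addrAC; congr (_ + _).
    by rewrite -rmorphN -rmorphD/=; congr (_%:C); field.
  rewrite mulr_sumr; apply: eq_bigr => i _; rewrite /bump/= add1n addr0.
  rewrite gbinom_np//.
  by rewrite mulrA -rmorphM.
have p1C : (p - 1)%:C != 0 by rewrite (inj_eq (@complexI R)).
have -> : (p / (p - 1))%:C = ((p - 1)%:C + 1) / (p - 1)%:C.
  by rewrite -(rmorph1 (real_complex R)) -rmorphD -fmorphV -rmorphM subrK.
rewrite fmorphV /=; move: (p - 1)%:C p1C q0 => a a0 q0.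
by field; rewrite a0 q0.
Qed.

Lemma gbinom_nat m k : (k <= m)%N -> gbinom m%:R k = 'C(m, k)%:R :> R.
Proof.
move=> km; have k0 : k`!%:R != 0 :> R by rewrite pnatr_eq0 -lt0n fact_gt0.
rewrite /gbinom; apply: (mulIf k0); rewrite divfK// -natrM bin_ffact ffact_prod.
rewrite natr_prod; apply: eq_bigr => i _.
by rewrite natrB// ltnW// (leq_trans _ km).
Qed.

(** C(2n, n) is the n-th moment of 2 (1 + cos t) under dt / pi on [0, pi], an arcsine law; both
    sides obey the recursion [wallisS]. *)
Lemma central_binomial_wallis n :
  gbinom (n%:R * 2 + 0) n = 2 ^+ n * wallis R n / pi :> R.
Proof.
have pi0 : pi != 0 :> R by rewrite gt_eqF// pi_gt0.
rewrite addr0 -natrM gbinom_nat ?leq_pmulr//.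
elim: n => [|n IH]; first by rewrite bin0 expr0 wallis0 mul1r divff.
have n0 : n.+1%:R != 0 :> R by rewrite pnatr_eq0.
apply: (mulfI n0).
have -> : n.+1%:R * (2 ^+ n.+1 * wallis R n.+1 / pi) =
    2 * (2 * n%:R + 1) * (2 ^+ n * wallis R n / pi).
  transitivity (2 * 2 ^+ n * (n.+1%:R * wallis R n.+1) / pi).
    by rewrite exprS; ring.
  by rewrite wallisS; ring.
have -> : 2 * (2 * n%:R + 1) = (2 * (n * 2).+1)%N%:R :> R.
  by rewrite natrM -[(n * 2).+1%:R]natr1 natrM; ring.
rewrite -IH -!natrM; congr (_%:R).
have -> : (n.+1 * 2 = (n * 2).+2)%N by [].
rewrite -mul_bin_diag.
rewrite -mulnA (mul_bin_down (n * 2).+1 n)/=.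
have -> : ((n * 2).+1 - n = n.+1)%N by rewrite muln2 -addnn -addSn addnK.
by rewrite mulnA; congr (_ * _)%N; rewrite [RHS]mulnC.
Qed.

End lagrange_series0.

(** * Measures on a compact interval *)

Section moments_and_support.
Variable R : realType.
Implicit Types (mu : probR R) (K : R).

Lemma measurable_off_itv K : measurable (~` `[0, K] : set (measurableTypeR R)).
Proof. by apply: measurableC; exact: measurable_itv. Qed.

(** Every point off the support has a null open neighbourhood; intervals with rational endpoints
    reduce this family to a countable one. *)
Lemma measure_off_msupport mu : mu.-negligible (~` msupport mu).
Proof.
pose F (n : nat) : set (measurableTypeR R) := match unpickle n with
  | Some (a, b) => if mu `]ratr a : R, ratr b[%classic == 0%E
                   then `]ratr (a : rat) : R, ratr (b : rat)[%classic else set0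
  | None => set0 end.
have F0 n : mu.-negligible (F n).
  rewrite /F; case: unpickle => [[a b]|]; last exact: negligible_set0.
  case: ifPn => [/eqP ab0|_]; last exact: negligible_set0.
  by apply/negligibleP => //; exact: measurable_itv.
apply: negligibleS (negligible_bigcup F0) => x /=.
rewrite /msupport/= => /existsNP[U] /not_implyP[oU] /not_implyP[Ux /negP].
rewrite -leNgt => U0.
have {}U0 : mu U = 0%E by apply/eqP; rewrite eq_le U0 measure_ge0.
have /nbhs_ballP[e /= e0 eU] : nbhs x U by exact: open_nbhs_nbhs.
have [|a /= ] := @rat_in_itvoo R (x - e) x; first by rewrite ltrBlDr ltrDl.
rewrite in_itv/= => /andP[a1 a2].
have [|b /= ] := @rat_in_itvoo R x (x + e); first by rewrite ltrDl.
rewrite in_itv/= => /andP[b1 b2].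
have Fx n : F n x -> (\bigcup_k F k) x by exists n.
apply: (Fx (pickle (a, b))).
rewrite /F pickleK ifT; first by rewrite set_itvE/=; apply/andP.
rewrite eq_le measure_ge0 andbT -U0 le_measure ?inE//.
- exact: open_measurable.
- move=> y; rewrite /= in_itv/= => /andP[ay yb]; apply: eU.
  by rewrite /ball/= ltr_norml ltrNl opprB; apply/andP; split; lra.
Qed.

(** Integrals only see null sets, so the topological condition is traded for nullity off an
    interval, both to exploit it for nu and to establish it for the measures constructed. *)
Lemma compactly_supported_nnegP mu : compactly_supported_nneg mu <->
  exists2 K, 0 < K & mu (~` `[0, K]) = 0%E.
Proof.
split=> [[cmu mu0]|[K K0 muK]].
  have [M [Mr HM]] := compact_bounded cmu.
  pose K := `|M| + 1; have MK : M < K by rewrite (le_lt_trans (ler_norm _))// ltrDl.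
  exists K; first by rewrite ltr_wpDl.
  apply: measure_negligible; first exact: measurable_off_itv.
  apply: negligibleS (measure_off_msupport mu) => x /= xK xs; apply: xK.
  rewrite in_itv/=; apply/andP; split; first exact: mu0.
  exact: le_trans (ler_norm _) (HM _ MK _ xs).
have sK : msupport mu `<=` `[0, K].
  move=> x; apply: contraPP => xK; move=> /(_ (~` `[0, K])) xs.
  have : (0 < mu (~` `[0%R, K]))%E.
    by apply: xs => //; rewrite openC; exact: itv_closed.
  by rewrite muK ltxx.
split; last by move=> x /sK; rewrite /= in_itv/= => /andP[].
apply: subclosed_compact (@segment_compact _ 0 K) sK.
rewrite -openC openE => x /= /existsNP[U] /not_implyP[oU] /not_implyP[Ux U0].
rewrite /interior nbhsE; exists U; first by split.
by move=> y Uy /= /(_ U oU Uy).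
Qed.

Variables (mu : probR R) (K : R).
Hypotheses (K0 : 0 < K) (muK : mu (~` `[0, K]) = 0%E).

Lemma itv_integrable (f : measurableTypeR R -> R) B : measurable_fun setT f ->
  (forall x, 0 <= x <= K -> `|f x| <= B) -> mu.-integrable setT (EFin \o f).
Proof.
move=> mf fB; apply/(negligible_integrable (measurable_off_itv K)) => //.
  exact/measurable_EFinP.
rewrite setTD setCK; apply: measurable_bounded_integrable.
- exact: measurable_itv.
- by rewrite ltey_eq fin_num_measure//; exact: measurable_itv.
- exact: measurable_funTS.
- exists B; split; first exact: num_real.
  move=> M BM x; rewrite /= in_itv/= => /fB /le_trans; apply; exact: ltW.
Qed.

Lemma normr_Rintegral_itv (f : measurableTypeR R -> R) B : measurable_fun setT f ->
  (forall x, 0 <= x <= K -> `|f x| <= B) -> `|\int[mu]_x f x| <= B.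
Proof.
move=> mf fB; have mitv : measurable (`[0, K]%classic : set (measurableTypeR R)).
  exact: measurable_itv.
have intf := itv_integrable mf fB.
have B0 : 0 <= B by apply: le_trans (fB 0 _); rewrite // lexx ltW.
have -> : \int[mu]_x f x = \int[mu]_(x in `[0, K]) f x.
  rewrite /Rintegral (negligible_integral (measurable_off_itv K) _ intf muK)//.
  by rewrite setTD setCK.
have intK : mu.-integrable `[0, K] (EFin \o f) by apply: integrableS intf.
rewrite (le_trans (le_normr_Rintegral _ intK))//.
apply: (@le_trans _ _ (\int[mu]_(x in `[0, K]) B)).
  apply: le_Rintegral => //.
  - exact: integrable_norm.
  - apply: measurable_bounded_integrable => //.
    by rewrite ltey_eq fin_num_measure.
    exists `|B|; split; first exact: num_real.
    by move=> M BM x _ /=; exact: ltW.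
rewrite Rintegral_cst// ler_piMr// -lee_fin fineK ?probability_le1//.
by rewrite fin_num_measure.
Qed.

Variable m : nat -> R.
Hypothesis mE : forall n, (\int[mu]_x (x ^+ n)%:E = (m n)%:E)%E.

Lemma itv_integrable_exp n :
  mu.-integrable setT (fun x : measurableTypeR R => (x ^+ n)%:E).
Proof.
apply: (@itv_integrable (fun x => x ^+ n) (K ^+ n)).
  by apply: exprn_measurable.
by move=> x /andP[x0 xK]; rewrite ger0_norm ?exprn_ge0// lerXn2r ?nnegrE ?(ltW K0).
Qed.

Lemma Rintegral_moment_sum (c : nat -> R) N :
  mu.-integrable setT (fun x : measurableTypeR R => (\sum_(n < N) c n * x ^+ n)%:E) /\
  \int[mu]_x (\sum_(n < N) c n * x ^+ n) = \sum_(n < N) c n * m n.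
Proof.
elim: N => [|N [IH1 IH2]].
  under eq_fun do rewrite big_ord0.
  under eq_Rintegral do rewrite big_ord0.
  by rewrite big_ord0 Rintegral_cst// mul0r; split => //; exact: integrable0.
have iN : mu.-integrable setT (fun x : measurableTypeR R => (c N * x ^+ N)%:E).
  by under eq_fun do rewrite EFinM; apply: integrableZl => //; exact: itv_integrable_exp.
under eq_fun do rewrite big_ord_recr/= EFinD.
under eq_Rintegral do rewrite big_ord_recr/=.
rewrite big_ord_recr/=; split; first exact: integrableD.
rewrite RintegralD// IH2; congr (_ + _).
rewrite RintegralZl//; last exact: itv_integrable_exp.
by rewrite /Rintegral mE.
Qed.

Lemma Rintegral_approx (f : measurableTypeR R -> R) (c : nat -> R) N B e :
  measurable_fun setT f -> (forall x, 0 <= x <= K -> `|f x| <= B) ->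
  (forall x, 0 <= x <= K -> `|f x - \sum_(n < N) c n * x ^+ n| <= e) ->
  `|\int[mu]_x f x - \sum_(n < N) c n * m n| <= e.
Proof.
move=> mf fB fe; have [i1 i2] := Rintegral_moment_sum c N.
rewrite -i2 -RintegralB//; last exact: itv_integrable fB.
apply: normr_Rintegral_itv => //.
apply: measurable_funB => //.
by have /integrableP[/measurable_EFinP] := i1.
Qed.

Lemma measurable_invc_affine (w : R[i]) :
  measurable_fun setT (fun x : measurableTypeR R => Re (1 - x%:C * w)^-1) /\
  measurable_fun setT (fun x : measurableTypeR R => Im (1 - x%:C * w)^-1).
Proof.
case: w => a b.
have mx : measurable_fun setT (fun x : measurableTypeR R => 1 - x * a).
  by apply: measurable_funB => //; exact: measurable_funM.
have my : measurable_fun setT (fun x : measurableTypeR R => - (x * b)).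
  by apply: measurable_funN; exact: measurable_funM.
pose D := fun x : measurableTypeR R => (1 - x * a) ^+ 2 + (- (x * b)) ^+ 2.
have mD : measurable_fun setT (fun x => (D x)^-1).
  rewrite (_ : (fun x => _) = (fun x => D x `^ (-1))); last first.
    by apply/funext => x; rewrite powR_inv1// addr_ge0// sqr_ge0.
  apply: (measurableT_comp (@measurable_powR R (-1))).
  by apply: measurable_funD; exact: measurable_funX.
have E x : 1 - x%:C * (a +i* b) = (1 - x * a) +i* (- (x * b)).
  by apply: complex_ext => /=; ring.
split.
  rewrite (_ : (fun x => _) = (fun x => (1 - x * a) * (D x)^-1)).
    exact: measurable_funM.
  by apply/funext => x; rewrite E.
rewrite (_ : (fun x => _) = (fun x => - ((- (x * b)) * (D x)^-1))).
  by apply: measurable_funN; exact: measurable_funM.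
by apply/funext => x; rewrite E /= mulNr.
Qed.

(** On [0, K] the ratio |x w| is at most 1/2, so the geometric tail is at most 2 / 2^N; real and
    imaginary parts each contribute this amount. *)
Lemma Mtransform_series w N : K * normc w <= 1 / 2 ->
  normc (Mtransform mu w - \sum_(n < N) (m n)%:C * w ^+ n) <= 4 / 2 ^+ N.
Proof.
move=> Kw.
have xw x : 0 <= x <= K -> normc (x%:C * w) <= 1 / 2.
  move=> /andP[x0 xK]; rewrite normcM normc_real ger0_norm// (le_trans _ Kw)//.
  by rewrite ler_wpM2r ?normc_ge0.
have inv2 x : 0 <= x <= K -> normc (1 - x%:C * w)^-1 <= 2 /\ 1 - x%:C * w != 0.
  move=> /xw xw2; have := lerB_normc 1 (- (x%:C * w)).
  rewrite normc1 normc_opp => h; have h2 : 1 / 2 <= normc (1 - x%:C * w) by lra.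
  have h0 : 0 < normc (1 - x%:C * w) by lra.
  by rewrite normcV invf_ple ?posrE//; split; [lra|rewrite -normc_gt0].
have tail x : 0 <= x <= K ->
    normc ((1 - x%:C * w)^-1 - \sum_(n < N) (x%:C * w) ^+ n) <= 2 / 2 ^+ N.
  move=> xK; have [i2 i0] := inv2 x xK.
  have -> : (1 - x%:C * w)^-1 - \sum_(n < N) (x%:C * w) ^+ n =
      (1 - x%:C * w)^-1 * (x%:C * w) ^+ N.
    have geom (q : R[i]) : (1 - q) * \sum_(n < N) q ^+ n = 1 - q ^+ N.
      by rewrite -opprB mulNr -subrX1 opprB.
    by apply: (mulfI i0); rewrite mulrBr geom mulrA divff// mul1r opprB subrKC.
  rewrite normcM normcX ler_pM ?exprn_ge0 ?normc_ge0//.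
  by rewrite -exprVn -div1r lerXn2r ?nnegrE ?normc_ge0// xw.
have [mRe mIm] := measurable_invc_affine w.
have sE (x : R) : \sum_(n < N) (x%:C * w) ^+ n =
    (\sum_(n < N) Re (w ^+ n) * x ^+ n) +i* (\sum_(n < N) Im (w ^+ n) * x ^+ n).
  elim: (N) => [|k IH]; first by rewrite !big_ord0.
  rewrite !big_ord_recr/= IH exprMn -rmorphXn/=.
  by apply: complex_ext; rewrite ?ReD ?ImD ?ReM ?ImM/=; ring.
have -> : \sum_(n < N) (m n)%:C * w ^+ n =
    (\sum_(n < N) Re (w ^+ n) * m n) +i* (\sum_(n < N) Im (w ^+ n) * m n).
  elim: (N) => [|k IH]; first by rewrite !big_ord0.
  rewrite !big_ord_recr/= IH.
  by apply: complex_ext; rewrite ?ReD ?ImD ?ReM ?ImM/=; ring.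
rewrite (le_trans (normc_le _))//.
have -> : 4 / 2 ^+ N = 2 / 2 ^+ N + 2 / 2 ^+ N :> R by rewrite -mulrDl; congr (_ / _); ring.
rewrite lerD//.
  rewrite (raddfB (@complex.Re R : Rcomplex R -> R))/=.
  apply: (Rintegral_approx (c := fun n => Re (w ^+ n)) mRe (B := 2)) => x xK.
    by rewrite (le_trans (normc_Re _))//; case: (inv2 x xK).
  have := le_trans (normc_Re _) (tail x xK).
  by rewrite sE (raddfB (@complex.Re R : Rcomplex R -> R)).
rewrite (raddfB (@complex.Im R : Rcomplex R -> R))/=.
apply: (Rintegral_approx (c := fun n => Im (w ^+ n)) mIm (B := 2)) => x xK.
  by rewrite (le_trans (normc_Im _))//; case: (inv2 x xK).
have := le_trans (normc_Im _) (tail x xK).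
by rewrite sE (raddfB (@complex.Im R : Rcomplex R -> R)).
Qed.

End moments_and_support.

(** * Image of a density, together with an atom *)

Section scaled_dirac.
Context d (T : measurableType d) (R : realType).
Variables (c : {nonneg R}) (c1 : c%:num <= 1) (x : T).

(** The bound is an argument so that the subprobability instance can recover its proof from the
    term; likewise for [normalized_measure]. *)
Definition scaled_dirac & c%:num <= 1 : set T -> \bar R := mscale c (\d_x).

HB.instance Definition _ := Measure.on (scaled_dirac c1).

Lemma scaled_dirac_setT : (scaled_dirac c1 setT <= 1)%E.
Proof. by rewrite /scaled_dirac /mscale/= diracT mule1 lee_fin. Qed.

HB.instance Definition _ :=
  Measure_isSubProbability.Build _ _ _ (scaled_dirac c1) scaled_dirac_setT.

Lemma ge0_integral_scaled_dirac (h : T -> \bar R) :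
  measurable_fun setT h -> (forall y, 0 <= h y)%E ->
  (\int[scaled_dirac c1]_y h y = (c%:num)%:E * h x)%E.
Proof.
by move=> mh h0; rewrite ge0_integral_mscale// integral_dirac// diracT mul1e.
Qed.

End scaled_dirac.

Lemma image_density_exists d d' (T : measurableType d) (T' : measurableType d')
    (R : realType) (P : probability T R) (g : T -> R) (X : T -> T') :
  measurable_fun setT g -> measurable_fun setT X -> (forall t, 0 <= g t <= 1) ->
  exists nu : subprobability T' R, forall h : T' -> \bar R,
    measurable_fun setT h -> (forall y, 0 <= h y)%E ->
    (\int[nu]_y h y = \int[P]_t ((g t)%:E * h (X t)))%E.
Proof.
move=> mg mX g01.
have g0 t : 0 <= g t by case/andP: (g01 t).
have g1 t : (NngNum (g0 t))%:num <= 1 by case/andP: (g01 t).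
(* The image under [X] of [P] with density [g] is the Giry bind of [P] with
   the subprobability kernel t |-> g t *: dirac (X t). *)
pose k t : giry T' R := scaled_dirac (X t) (g1 t).
have mk : measurable_fun setT k.
  apply: measurable_giry_codensity => // B mB.
  rewrite (_ : (fun t => k t B) = (fun t => ((g t)%:E * (\1_B (X t))%:E)%E)).
    apply: emeasurable_funM; first exact/measurable_EFinP.
    apply/measurable_EFinP; apply: (measurableT_comp _ mX).
    exact: measurable_indic.
  by apply/funext => t.
exists (giry_bind P mk) => h mh h0.
have := giry_int_bind P mk mh h0; rewrite /giry_int => ->.
by apply: eq_integral => t _; rewrite ge0_integral_scaled_dirac.
Qed.

Section normalized_measure.
Context d (T : measurableType d) (R : realType).
Variables (m : {measure set T -> \bar R}) (m1 : m setT = 1%E).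

Definition normalized_measure & m setT = 1%E : set T -> \bar R := m.

HB.instance Definition _ := Measure.on (normalized_measure m1).

HB.instance Definition _ :=
  Measure_isProbability.Build _ _ _ (normalized_measure m1) m1.

End normalized_measure.

Section density_on_0_pi.
Variable R : realType.
Local Notation mu := (@lebesgue_measure R).

Lemma atom_density_exists (X g : measurableTypeR R -> measurableTypeR R) (B a x0 : R) :
  measurable_fun setT g -> measurable_fun setT X ->
  (forall t, 0 <= g t <= B) -> 0 <= a ->
  (\int[mu]_(t in `[0%R, pi]) (g t)%:E = (pi * (1 - a))%:E)%E ->
  exists nu : probR R, forall h : measurableTypeR R -> \bar R,
    measurable_fun setT h -> (forall y, 0 <= h y)%E ->
    (\int[nu]_y h y = a%:E * h x0 +
      pi^-1%:E * \int[mu]_(t in `[0%R, pi]) ((g t)%:E * h (X t)))%E.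
Proof.
move=> mg mX gB a0 mass.
(* [image_density_exists] takes densities bounded by 1: g is divided by [B1] and the image measure
   scaled back. The maximum with 1 makes [B1] positive. *)
pose B1 := Num.max B 1.
have B0 : 0 < B1 by rewrite lt_max ltr01 orbT.
have pi0 := pi_gt0 R.
have mgB : measurable_fun setT (fun t => B1^-1 * g t) by exact: measurable_funM.
have gB01 t : 0 <= B1^-1 * g t <= 1.
  have /andP[g0 gB'] := gB t; rewrite mulr_ge0 ?invr_ge0 ?(ltW B0)//=.
  by rewrite mulrC ler_pdivrMr// mul1r le_max gB'.
have [nu nuE] := @image_density_exists _ _ _ _ R (uniform_prob pi0) _ X mgB mX gB01.
pose m := measure_add (mscale (NngNum a0) (\d_(x0 : measurableTypeR R)))
  (mscale (NngNum (ltW B0)) nu).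
have mE (h : measurableTypeR R -> \bar R) :
    measurable_fun setT h -> (forall y, 0 <= h y)%E ->
    (\int[m]_y h y = a%:E * h x0 +
      pi^-1%:E * \int[mu]_(t in `[0%R, pi]) ((g t)%:E * h (X t)))%E.
  move=> mh h0; rewrite ge0_integral_measure_add// !ge0_integral_mscale//.
  rewrite integral_dirac// diracT mul1e; congr (_ + _)%E.
  rewrite nuE// integral_uniform; last 2 first.
  - apply: emeasurable_funM; first exact/measurable_EFinP.
    exact: measurableT_comp.
  - by move=> t; apply: mule_ge0 => //; rewrite lee_fin; case/andP: (gB01 t).
  rewrite subr0 muleCA -ge0_integralZl//=; last 3 first.
  - apply: measurable_funTS; apply: emeasurable_funM; first exact/measurable_EFinP.
    exact: measurableT_comp.
  - by move=> t _; apply: mule_ge0 => //; rewrite lee_fin; case/andP: (gB01 t).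
  - by rewrite lee_fin ltW.
  congr (_ * _)%E; apply: eq_integral => t _.
  by rewrite muleA -EFinM mulrA divff ?mul1r// gt_eqF.
have m1 : m setT = 1%E.
  transitivity (\int[m]_y cst 1 y)%E; first by rewrite integral_cst// mul1e.
  rewrite mE//.
  rewrite mule1.
  under eq_integral do rewrite mule1.
  by rewrite mass -EFinM mulKf ?gt_eqF// -EFinD addrC subrK.
exists (normalized_measure m1 : probR R) => h mh h0.
by rewrite -mE.
Qed.

End density_on_0_pi.

(** * S-transforms *)

Section S_transforms.
Variable R : realType.
Implicit Types (mu nu : probR R) (S : R[i] -> R[i]).

Lemma derivable_bounded_near0 S : 
  (\forall z \near (0 : R[i]^o), derivable (S : R[i]^o -> R[i]^o) z 1) ->
  exists C d : R, [/\ 0 < C, 0 < d & forall z, normc z < d -> normc (S z) <= C].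
Proof.
move=> /nbhs_singleton/derivableP/is_deriveCP/(_ 1 ltr01)[d d0 H].
set dS := derive (S : R[i]^o -> R[i]^o) _ _ in H.
exists (normc (S 0) + normc dS + 2), (Num.min d 1); split.
- by rewrite ltr_wpDl// addr_ge0// normc_ge0.
- by rewrite lt_min d0 ltr01.
move=> z; rewrite lt_min => /andP[/H]; rewrite add0r mul1r => h z1.
have -> : S z = (S z - S 0 - z * dS) + (S 0 + z * dS) by ring.
rewrite (le_trans (normcD _ _))//.
have := normcD (S 0) (z * dS); rewrite normcM => h2.
have : normc z * normc dS <= 1 * normc dS by rewrite ler_wpM2r ?normc_ge0// ltW.
lra.
Qed.

(** Since S is bounded near 0, w = z / (1 + z) S(z) is small there and the moment sums at w
    approximate M_mu(w); by uniqueness of limits it is enough that they also approximate 1 + z. The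
    nonzero mean excludes the point mass at 0. *)
Lemma is_StransformI mu (K : R) (m : nat -> R) S : 0 < K -> mu (~` `[0, K]) = 0%E ->
  (forall n, \int[mu]_x (x ^+ n)%:E = (m n)%:E)%E -> m 1%N != 0 ->
  (\forall z \near (0 : R[i]^o), derivable (S : R[i]^o -> R[i]^o) z 1) ->
  (exists2 d : R, 0 < d & forall z, normc z < d ->
    K * normc (z / (1 + z) * S z) <= 1 / 2 ->
    geo_approx (fun N => \sum_(n < N) (m n)%:C * (z / (1 + z) * S z) ^+ n) (1 + z)) ->
  is_Stransform mu S.
Proof.
move=> K0 muK mE m1 dS [d d0 Hd]; split => //.
- by apply/compactly_supported_nnegP; exists K.
- move=> mu0; have := mE 1%N.
  rewrite (eq_measure_integral (\d_(0 : measurableTypeR R))); last first.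
    by move=> A mA _; exact: mu0.
  rewrite integral_dirac//; last first.
    by apply/measurable_EFinP; exact: measurable_funX.
  rewrite expr1 mule0 => -[] m10; by rewrite -m10 eqxx in m1.
- have [C [d1 [C0 d10 HC]]] := derivable_bounded_near0 dS.
  (* The last bound gives |z| < 1/2, hence |1 / (1 + z)| <= 2, and 2 K C |z| <= 1/2. *)
  apply/near0C; exists (Num.min d (Num.min d1 (1 / (4 * K * C + 2)))).
    by rewrite !lt_min d0 d10 divr_gt0// ltr_wpDl// !mulr_ge0// ltW.
  move=> z; rewrite !lt_min ltr_pdivlMr; last by rewrite ltr_wpDl// !mulr_ge0// ltW.
  move=> /andP[zd /andP[zd1 zK]].
  have z0 := normc_ge0 z.
  have KC0 : 0 <= normc z * (K * C) by rewrite !mulr_ge0// ltW.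
  have w2 : K * normc (z / (1 + z) * S z) <= 1 / 2.
    have h1 : 1 / 2 <= normc (1 + z).
      have := lerB_normc 1 z; rewrite normc1; lra.
    have h2 : normc (1 + z)^-1 <= 2.
      by rewrite normcV invf_ple ?posrE//; lra.
    rewrite normcM normcM.
    apply: (@le_trans _ _ (K * (2 * normc z * C))).
      rewrite ler_wpM2l ?(ltW K0)//.
      apply: ler_pM; rewrite ?mulr_ge0 ?normc_ge0//.
        by rewrite mulrC ler_wpM2r.
      exact: HC.
    lra.
  apply: (@geo_approx_unique R _ _ _ _ (Hd z zd w2)).
  exists 4 => N; rewrite normc_distrC.
  exact: (Mtransform_series K0 muK mE N w2).
Qed.

(** [rho] is the image of nu under division by c. *)
Lemma dilation_exists nu (c K : R) (m : nat -> R) : 0 < c -> 0 < K ->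
  nu (~` `[0, K]) = 0%E -> (forall n, \int[nu]_x (x ^+ n)%:E = (m n)%:E)%E ->
  exists rho : probR R, [/\ same_measure nu (dilation c rho),
    rho (~` `[0, c^-1 * K]) = 0%E &
    forall n, (\int[rho]_x (x ^+ n)%:E = (c^-1 ^+ n * m n)%:E)%E].
Proof.
move=> c0 K0 nuK mE.
have mX : @measurable_fun _ _ (measurableTypeR R) (measurableTypeR R) setT
    (fun x : R => c^-1 * x).
  exact: measurable_funM.
pose X : {mfun measurableTypeR R >-> measurableTypeR R} :=
  @mfun_Sub _ _ (measurableTypeR R) (measurableTypeR R) _ (mem_set mX).
exists (distribution nu X); split.
- move=> A mA; rewrite /dilation /distribution /pushforward; congr (nu _).
  apply/seteqP; split => x /=; first by move=> Ax; exists x.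
  by move=> [y Ay] /(mulfI (invr_neq0 (lt0r_neq0 c0))) <-.
- rewrite /distribution /pushforward; rewrite -nuK; congr (nu _).
  apply/seteqP; split => x /=; rewrite !in_itv/=; apply: contra_not.
    by rewrite ler_pM2l ?invr_gt0// pmulr_rge0 ?invr_gt0.
  by rewrite ler_pM2l ?invr_gt0// pmulr_rge0 ?invr_gt0.
- move=> n; rewrite integral_distribution.
  + rewrite EFinM -mE -integralZl//; last exact: (itv_integrable_exp K0 nuK).
    by apply: eq_integral => x _; rewrite /= exprMn EFinM.
  + by apply/measurable_EFinP; exact: measurable_funX.
  + apply: eq_integrable (integrableZl measurableT (c^-1 ^+ n)
      (itv_integrable_exp K0 nuK n)) => //.
    by move=> x _; rewrite /= exprMn EFinM.
Qed.

Lemma is_nuP (p r : R) nu : is_nu p r nu -> exists2 K, 0 < K &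
  nu (~` `[0, K]) = 0%E /\
  forall n, (\int[nu]_x (x ^+ n)%:E = (gbinom (n%:R * p + r) n)%:E)%E.
Proof. by case=> /compactly_supported_nnegP[K K0 nuK] mE; exists K. Qed.

Lemma measurable_normrX n :
  measurable_fun setT (fun x : measurableTypeR R => (`|x| ^+ n)%:E).
Proof.
apply/measurable_EFinP; apply: measurable_funX.
exact: (@normr_measurable R setT).
Qed.

(** The integration formulas for [two_atoms] and [sigma] are stated for integrands nonnegative on
    the whole line, whereas x^n is so only almost everywhere. *)
Lemma integral_expr_normr nu (K : R) n : nu (~` `[0, K]) = 0%E ->
  (\int[nu]_x (x ^+ n)%:E = \int[nu]_x (`|x| ^+ n)%:E)%E.
Proof.
move=> nuK; apply: ae_eq_integral => //.
- by apply/measurable_EFinP; exact: measurable_funX.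
- exact: measurable_normrX.
- exists (~` `[0, K]); split => //; first exact: measurable_off_itv.
  move=> x /=; apply: contra_not; rewrite in_itv/= => /andP[x0 xK] _.
  by rewrite ger0_norm.
Qed.

Lemma ge0_integral_two_atoms (p : R) (p1 : 1 < p) (h : measurableTypeR R -> \bar R) :
  measurable_fun setT h -> (forall y, 0 <= h y)%E ->
  (\int[two_atoms p1]_x h x =
    (1 / p)%:E * h (0 : R)%R + ((p - 1) / p)%:E * h (1 : R)%R)%E.
Proof.
move=> mh h0; rewrite /two_atoms ge0_integral_measure_add// !ge0_integral_mscale//.
by rewrite !integral_dirac// !diracT !mul1e.
Qed.

Lemma two_atoms_off_itv (p : R) (p1 : 1 < p) : two_atoms p1 (~` `[0, 1]) = 0%E.
Proof.
rewrite two_atomsE !diracE !memNset ?mule0 ?adde0//= in_itv/= ?lexx ?ler01; exact.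
Qed.

Lemma two_atoms_moment (p : R) (p1 : 1 < p) n :
  (\int[two_atoms p1]_x (x ^+ n)%:E =
   (if n is 0 then 1 else (p - 1) / p)%:E)%E.
Proof.
have p0 : p != 0 by rewrite gt_eqF// (lt_trans ltr01).
rewrite (integral_expr_normr _ (two_atoms_off_itv p1)) ge0_integral_two_atoms//.
  rewrite normr0 normr1 expr1n mule1 -EFinM -EFinD; congr EFin.
  case: n => [|n]; first by rewrite expr0; field.
  by rewrite exprS mul0r mulr0 add0r.
exact: measurable_normrX.
Qed.

End S_transforms.

(** * The additive power of the two-atom law *)

Section two_atoms_additive_power.
Variable R : realType.
Local Notation mu := (@lebesgue_measure R).

(** Written as in [lagrange_series0] at p = 2, which gives the generating function (1 + y) / (1 - y)
    at the point y / (1 + y)^2. *)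
Definition central_binomial n : R := gbinom (n%:R * 2 + 0) n.

Variables (p : R) (p1 : 1 < p).

Let X (t : R) : R := 2 / p * (1 + cos t).

Let p0 : 0 < p. Proof. exact: lt_trans p1. Qed.

Let X_ge0 t : 0 <= X t.
Proof.
by rewrite mulr_ge0 ?divr_ge0 ?(ltW p0)//; have := cos_geN1 t; lra.
Qed.

Let continuous_X : continuous X.
Proof.
move=> t; apply: cvgM; first exact: cvg_cst.
by apply: cvgD; [exact: cvg_cst|exact: continuous_cos].
Qed.

(* [gX] says that (p - (p - 1) x) sigma(dx) is the image of (1 - cos t) dt / pi;
   the atom at p / (p - 1) does not contribute to it. *)
Lemma measure_of_density (g : R -> R) (B a : R) : continuous g ->
  (forall t, 0 <= g t <= B) -> 0 <= a ->
  \int[mu]_(t in `[0, pi]) g t = pi * (1 - a) ->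
  (forall t, g t * (p - (p - 1) * X t) = 1 - cos t) ->
  exists (sigma : probR R) (K : R) (s : nat -> R), [/\ 0 < K,
    sigma (~` `[0, K]) = 0%E,
    forall n, (\int[sigma]_x (x ^+ n)%:E = (s n)%:E)%E &
    s 0%N = 1 /\ forall n, p * s n - (p - 1) * s n.+1 =
      p^-1 ^+ n * ((4 * central_binomial n - central_binomial n.+1) / 2)].
Proof.
move=> cg gB a0 mass gX.
have q0 : 0 < p - 1 by rewrite subr_gt0.
have pi0 := pi_gt0 R.
pose x0 := p / (p - 1); have x00 : 0 < x0 by rewrite divr_gt0.
have g0 t : 0 <= g t by case/andP: (gB t).
have mg : measurable_fun setT (g : measurableTypeR R -> measurableTypeR R).
  exact: continuous_measurable_fun.
have mX : measurable_fun setT (X : measurableTypeR R -> measurableTypeR R).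
  exact: continuous_measurable_fun.
have igX (f : R -> R) : continuous f -> mu.-integrable `[0, pi] (EFin \o (fun t => g t * f t)).
  move=> cf; apply: continuous_integrable_itv => t; apply: cvgM; first exact: cg.
  exact: cf.
have ig : mu.-integrable `[0, pi] (EFin \o g) by exact: continuous_integrable_itv.
have [|sigma sE] := @atom_density_exists R X g B a x0 mg mX gB a0.
  rewrite -mass /Rintegral fineK//; exact: integrable_fin_num ig.
pose K := Num.max x0 (4 / p).
have K0 : 0 < K by rewrite lt_max x00.
have XK t : 0 <= X t <= K.
  rewrite X_ge0 le_max; apply/orP; right.
  rewrite /X ler_pdivlMr// mulrAC divfK ?gt_eqF//; have := cos_le1 t; lra.
have sK : sigma (~` `[0, K]) = 0%E.
  have mK := measurable_off_itv K.
  rewrite -[LHS](_ : \int[sigma]_x (\1_(~` `[0%R, K]) x)%:E = _)%E; last first.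
    by rewrite integral_indic// setIT.
  have off x : 0 <= x <= K -> \1_(~` `[0, K]) x = 0 :> R.
    by move=> xK; rewrite indicE memNset//= in_itv/= xK; exact.
  rewrite sE//; last first.
    by apply/measurable_EFinP; exact: measurable_indic.
  rewrite off ?mule0 ?add0e; last by rewrite (ltW x00) le_max lexx.
  by rewrite integral0_eq ?mule0// => t _; rewrite off ?mule0.
have cX n : continuous (fun t => X t ^+ n).
  move=> t; apply: (@continuous_comp _ _ _ X (fun y => y ^+ n)); first exact: continuous_X.
  exact: exprn_continuous.
pose s n := a * x0 ^+ n + pi^-1 * \int[mu]_(t in `[0, pi]) (g t * X t ^+ n).
exists sigma, K, s; split => //.
  move=> n; rewrite (integral_expr_normr _ sK) sE//; last exact: measurable_normrX.
  rewrite /s EFinD !EFinM ger0_norm ?(ltW x00)//; congr (_ + _ * _)%E.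
  rewrite /Rintegral fineK; last by apply: integrable_fin_num => //; exact: igX.
  by apply: eq_integral => t _; rewrite ger0_norm.
split.
  rewrite /s expr0 mulr1.
  under eq_Rintegral do rewrite expr0 mulr1.
  by rewrite mass mulKf ?gt_eqF// addrC subrK.
move=> n.
transitivity (a * x0 ^+ n * (p - (p - 1) * x0) +
   pi^-1 * (p * \int[mu]_(t in `[0, pi]) (g t * X t ^+ n) -
     (p - 1) * \int[mu]_(t in `[0, pi]) (g t * X t ^+ n.+1))).
  by rewrite /s exprS; ring.
have -> : p - (p - 1) * x0 = 0 by rewrite /x0; field; rewrite gt_eqF.
rewrite mulr0 add0r -!RintegralZl//; [|exact: igX..].
have iZ (b : R) k : mu.-integrable `[0, pi] (EFin \o (fun t => b * (g t * X t ^+ k))).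
  apply: continuous_integrable_itv => t; apply: cvgM; first exact: cvg_cst.
  by apply: cvgM; [exact: cg|exact: cX].
rewrite -RintegralB//.
have -> : \int[mu]_(t in `[0, pi]) (p * (g t * X t ^+ n) - (p - 1) * (g t * X t ^+ n.+1)) =
    \int[mu]_(t in `[0, pi]) ((2 / p) ^+ n * (2 * (1 + cos t) ^+ n - (1 + cos t) ^+ n.+1)).
  apply: eq_Rintegral => t _.
  transitivity (g t * (p - (p - 1) * X t) * X t ^+ n); first by rewrite exprS; ring.
  by rewrite gX {1}/X exprMn exprS; ring.
have iw k : mu.-integrable `[0, pi] (EFin \o (fun t : R => (1 + cos t) ^+ k)).
  by apply: continuous_integrable_itv; exact: continuous_1Dcos_exp.
have i2w k : mu.-integrable `[0, pi] (EFin \o (fun t : R => 2 * (1 + cos t) ^+ k)).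
  apply: continuous_integrable_itv => t; apply: cvgM; first exact: cvg_cst.
  exact: continuous_1Dcos_exp.
rewrite RintegralZl//; last first.
  apply: continuous_integrable_itv => t; apply: cvgB; last exact: continuous_1Dcos_exp.
  apply: cvgM; first exact: cvg_cst.
  exact: continuous_1Dcos_exp.
rewrite RintegralB// RintegralZl// -!/(wallis R _).
rewrite /central_binomial !central_binomial_wallis exprMn exprS exprVn.
have pin : pi != 0 :> R by rewrite gt_eqF.
move: (wallis R n) (wallis R n.+1) (pi : R) pin => w w' P P0.
by field; rewrite P0 expf_neq0// gt_eqF.
Qed.

(** The right-hand side of the recursion is p^(-n) times the n-th Catalan number. With q = p - 1,
    one has p - (p - 1) X t = D t / p, which forces g = p (1 - cos t) / D t. As D vanishes at t = 0
    when q = 1, the case p = 2 is separate; there g is the constant 1. *)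
Lemma two_atoms_additive_power_exists :
  exists (sigma : probR R) (K : R) (s : nat -> R), [/\ 0 < K,
    sigma (~` `[0, K]) = 0%E,
    forall n, (\int[sigma]_x (x ^+ n)%:E = (s n)%:E)%E &
    s 0%N = 1 /\ forall n, p * s n - (p - 1) * s n.+1 =
      p^-1 ^+ n * ((4 * central_binomial n - central_binomial n.+1) / 2)].
Proof.
have pi0 := pi_gt0 R.
have [p2|p2] := eqVneq p 2.
  apply: (@measure_of_density (fun=> 1) 1 0) => //.
  - by move=> t; exact: cvg_cst.
  - by move=> t; rewrite ler01 lexx.
  - rewrite subr0 mulr1; have := wallis0 R; rewrite /wallis.
    by under eq_Rintegral do rewrite expr0.
  - by move=> t; rewrite /X p2; field.
set q := p - 1; have pq : p = 1 + q by rewrite /q; ring.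
have q0 : 0 < q by rewrite subr_gt0.
have q1 : q != 1 by apply: contra_neq p2 => q1; rewrite pq q1.
have e0 : 0 < (1 - q) ^+ 2 by rewrite exprn_even_gt0//= subr_eq0 eq_sym.
pose D t := 1 - 2 * q * cos t + q ^+ 2.
have De t : (1 - q) ^+ 2 <= D t.
  have : q * cos t <= q * 1 by rewrite ler_wpM2l ?(ltW q0)// cos_le1.
  by rewrite /D; lra.
have D0 t : 0 < D t by exact: lt_le_trans (De t).
have cD : continuous D.
  move=> t; apply: cvgD; last exact: cvg_cst.
  apply: cvgB; first exact: cvg_cst.
  by apply: cvgM; [exact: cvg_cst|exact: continuous_cos].
have cf : continuous (fun t => (1 - cos t) / D t).
  move=> t; apply: cvgM.
    by apply: cvgB; [exact: cvg_cst|exact: continuous_cos].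
  by apply: cvgV; [rewrite gt_eqF|exact: cD].
have c0 (t : R) : 0 <= 1 - cos t by rewrite subr_ge0 cos_le1.
pose g t := p * ((1 - cos t) / D t).
have gB t : 0 <= g t <= p * (2 / (1 - q) ^+ 2).
  rewrite mulr_ge0 ?(ltW p0) ?divr_ge0 ?(ltW (D0 t))//= ler_wpM2l ?(ltW p0)//.
  apply: ler_pM => //; first by rewrite invr_ge0 ltW.
    by have := cos_geN1 t; lra.
  by rewrite lef_pV2 ?posrE.
have gX t : g t * (p - (p - 1) * X t) = 1 - cos t.
  have -> : p - (p - 1) * X t = D t / p.
    by rewrite /X /D pq; field; rewrite -pq gt_eqF.
  by rewrite /g; field; rewrite !gt_eqF.
have cg : continuous g by move=> t; apply: cvgM; [exact: cvg_cst|exact: cf].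
have mass (a : R) : \int[mu]_(t in `[0, pi]) ((1 - cos t) / D t) = pi * (1 - a) / p ->
    \int[mu]_(t in `[0, pi]) g t = pi * (1 - a).
  move=> h; rewrite /g RintegralZl//; last exact: continuous_integrable_itv.
  by rewrite h mulrC divfK// gt_eqF.
(* The total mass of g dt / pi is 1 if q < 1 and 1 / q if q > 1. *)
have [q1'|q1'|q1'] := ltgtP q 1; last by rewrite q1' eqxx in q1.
  apply: (@measure_of_density g _ 0 cg gB) => //; apply: mass.
  by rewrite subr0 mulr1 pq -Rintegral_poisson// q0.
apply: (@measure_of_density g _ (1 - q^-1) cg gB) => //.
  by rewrite subr_ge0 invf_le1// ltW.
apply: mass.
(* 1 - 2 q cos t + q^2 is q^2 times the same expression at 1 / q, so q > 1 is reduced to a ratio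
   below 1. *)
have r01 : 0 < q^-1 < 1 by rewrite invr_gt0 q0 invf_lt1.
have := Rintegral_poisson r01.
rewrite [X in X = _](_ : _ = q ^+ 2 * \int[mu]_(t in `[0, pi]) ((1 - cos t) / D t)).
  move=> h; have q2 : q ^+ 2 != 0 by rewrite expf_neq0// gt_eqF.
  apply: (mulfI q2); rewrite h pq; field; rewrite !gt_eqF//; lra.
rewrite -RintegralZl//; last exact: continuous_integrable_itv.
apply: eq_Rintegral => t _.
have -> : 1 - 2 * q^-1 * cos t + q^-1 ^+ 2 = D t / q ^+ 2.
  by rewrite /D; field; rewrite gt_eqF.
by field; rewrite !gt_eqF.
Qed.

End two_atoms_additive_power.

(** * Moebius S-transforms and the two identities *)

Section mobius_S_transforms.
Variable R : realType.
Implicit Types (a b k : R) (z : R[i]).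

(** The substitution y: a = b = p - 1 solves 1 / (1 - (p - 1) y) = 1 + z, and a = p, b = p - 1
    solves (1 + y) / (1 - (p - 1) y) = 1 + z. *)
Definition mob a b z : R[i] := z / (a%:C + b%:C * z).

(** Expressed through 1 + y because its power s is then k^s (1 + y)^(-s), the factor occurring in
    the Lagrange series. *)
Definition Smob a b k z : R[i] := k%:C * (1 + mob a b z)^-1.

Lemma mob_small a b (e : R) : 0 < a -> 0 < e -> exists2 d : R, 0 < d &
  forall z, normc z < d ->
    [/\ a%:C + b%:C * z != 0, normc (mob a b z) < e & normc z <= 1 / 2].
Proof.
move=> a0 e0; have b0 : 0 < `|b| + 1 by rewrite ltr_wpDl.
exists (Num.min (1 / 2) (Num.min (a / 2 / (`|b| + 1)) (e * (a / 2)))).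
  by rewrite !lt_min !divr_gt0 ?mulr_gt0 ?divr_gt0.
move=> z; rewrite !lt_min => /andP[z2 /andP[]]; rewrite ltr_pdivlMr// => zb ze.
have z0 := normc_ge0 z.
have den : a / 2 < normc (a%:C + b%:C * z).
  rewrite (lt_le_trans _ (lerB_normc _ _))// normcM !normc_real (gtr0_norm a0); lra.
have den0 : 0 < normc (a%:C + b%:C * z) by rewrite (lt_trans _ den) ?divr_gt0.
split; [by rewrite -normc_gt0| |exact: ltW].
rewrite /mob normcM normcV ltr_pdivrMr// (lt_trans ze)// ltr_pM2l//.
Qed.

Lemma derivable_Smob a b k z : a%:C + b%:C * z != 0 -> 1 + mob a b z != 0 ->
  derivable (Smob a b k : R[i]^o -> R[i]^o) z 1.
Proof.
move=> d0 m0.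
have dd : is_derive (z : R[i]^o) 1 ((fun z => a%:C + b%:C * z) : R[i]^o -> R[i]^o) b%:C.
  apply: is_derive_eq (is_deriveD (is_derive_cst _ _ _)
    (is_deriveZ b%:C (is_derive_id _ _))) _.
  by rewrite add0r /GRing.scale/= mulr1.
have dm := is_deriveD (is_derive_cst (1 : R[i]^o) (z : R[i]^o) 1)
  (@is_deriveM R[i] R[i]^o _ _ _ _ _ _ (is_derive_id (z : R[i]^o) 1) (is_derive_inv d0 dd)).
have := is_deriveZ k%:C (is_derive_inv m0 dm).
by case.
Qed.

Lemma derivable_Smob_near0 a b k : 0 < a ->
  \forall z \near (0 : R[i]^o), derivable (Smob a b k : R[i]^o -> R[i]^o) z 1.
Proof.
move=> a0; have [d d0 H] := @mob_small a b (1/2) a0 ltac:(by rewrite divr_gt0).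
apply/near0C; exists d => // z /H[h1 h2 _]; apply: derivable_Smob => //.
by apply: Re_gt0_neq0; have := Re_1D_gt0 (ltW h2); lra.
Qed.

Lemma derivable_cpow_Smob_near0 a b k s : 0 < a -> 0 < k ->
  \forall z \near (0 : R[i]^o),
    derivable ((fun z => cpow (Smob a b k z) s) : R[i]^o -> R[i]^o) z 1.
Proof.
move=> a0 k0; have [d d0 H] := @mob_small a b (1/2) a0 ltac:(by rewrite divr_gt0).
apply/near0C; exists d => // z /H[h1 h2 _].
have h3 : 0 < Re (1 + mob a b z) by have := Re_1D_gt0 (ltW h2); lra.
have h4 : 0 < Re (Smob a b k z).
  by rewrite /Smob ReM/= mul0r subr0 mulr_gt0// Re_inv_gt0.
have /derivable1_diffP dS := derivable_Smob (k := k) h1 (Re_gt0_neq0 h3).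
have [/derivable1_diffP dc _] := is_derive_cpow s h4.
apply/derivable1_diffP.
exact: (differentiable_comp dS dc).
Qed.

Lemma cpow_Smob a b k s z : 0 < k -> 0 < Re (1 + mob a b z) ->
  cpow (Smob a b k z) s = (k `^ s)%:C * cpow (1 + mob a b z) (- s).
Proof.
by move=> k0 r0; rewrite /Smob cpowM ?Re_inv_gt0// cpow_real// cpowV.
Qed.

End mobius_S_transforms.

Section proposition.
Variables (R : realType) (p : R) (p1 : 1 < p).

Let p0 : 0 < p. Proof. exact: lt_trans p1. Qed.
Let q0 : 0 < p - 1. Proof. by rewrite subr_gt0. Qed.
Let P0 : p%:C != 0. Proof. by rewrite (inj_eq (@complexI R)) gt_eqF. Qed.
Let Q0 : p%:C - 1 != 0.
Proof. by rewrite -(rmorph1 (real_complex R)) -rmorphB (inj_eq (@complexI R)) gt_eqF. Qed.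

Lemma is_Stransform_two_atoms :
  is_Stransform (two_atoms p1) (Smob (p - 1) (p - 1) (p / (p - 1))).
Proof.
apply: (is_StransformI ltr01 (two_atoms_off_itv p1) (two_atoms_moment p1)).
- by rewrite mulf_neq0 ?invr_neq0 ?gt_eqF.
- exact: derivable_Smob_near0.
have [d d0 H] := @mob_small R (p - 1) (p - 1) (1/2) q0 ltac:(by rewrite divr_gt0).
exists d => // z /H[h1 h2 z2].
have h3 : 1 + mob (p - 1) (p - 1) z != 0.
  by apply: Re_gt0_neq0; have := Re_1D_gt0 (ltW h2); lra.
set w := z / (1 + z) * _; rewrite [1 * normc w]mul1r => w2.
have z1 : 1 + z != 0.
  by apply: Re_gt0_neq0; have := Re_1D_gt0 z2; lra.
have mE : 1 + mob (p - 1) (p - 1) z = (p%:C - 1 + p%:C * z) / ((p%:C - 1) * (1 + z)).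
  by rewrite /mob rmorphB rmorph1 -[X in _ / (X + _)]mulr1 -mulrDr; field; rewrite z1 Q0.
have n0 : p%:C - 1 + p%:C * z != 0.
  by apply: contraNneq h3 => n0; rewrite mE n0 mul0r.
have wE : w = p%:C * z / (p%:C - 1 + p%:C * z).
  rewrite /w /Smob mE fmorph_div rmorphB rmorph1; field.
  by rewrite n0 z1 Q0.
have := geo_approxD (geo_approx_cst (1 / p)%:C)
  (geo_approxZ ((p - 1) / p)%:C (geo_approx_geometric w2)).
(* The shift brings in the zeroth moment, 1 = 1 / p + (p - 1) / p; all the others are (p - 1) /
   p. *)
move=> /geo_approxS h; apply/geo_approxS; apply: eq_geo_approx h => [N|].
  rewrite !big_ord_recl/= !expr0 !mulr1 mulrDr mulr1 addrA; congr (_ + _).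
    rewrite -rmorphD/= -mulrDl [1 + _]addrC subrK divff ?gt_eqF//.
  by rewrite mulr_sumr.
rewrite wE !fmorph_div rmorphB rmorph1; field.
have -> : p%:C - 1 + p%:C * z - p%:C * z = p%:C - 1 by ring.
by rewrite P0 Q0 n0.
Qed.

Lemma central_binomial01 : central_binomial R 0 = 1 /\ central_binomial R 1 = 2.
Proof.
rewrite /central_binomial gbinom0; split => //.
by have := gbinomS (1 * 2 + 0 : R) 0; rewrite gbinom0 !mul1r addr0 subr0 mulr1.
Qed.

Lemma one_add_mob z : p%:C + (p - 1)%:C * z != 0 -> 
  1 + mob p (p - 1) z = p%:C * (1 + z) / (p%:C + (p%:C - 1) * z).
Proof. by rewrite /mob rmorphB rmorph1 => n0; field. Qed.

Lemma is_Stransform_additive_power :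
  exists sigma : probR R, is_Stransform sigma (Smob p (p - 1) 1).
Proof.
have [sigma [K [s [K0 sK sE [s0 srec]]]]] := two_atoms_additive_power_exists p1.
exists sigma; have [b0 b1] := central_binomial01.
have s1 : s 1%N = 1.
  have := srec 0%N; rewrite s0 b0 b1 expr0 => h; apply: (mulfI (lt0r_neq0 q0)); lra.
apply: (is_StransformI K0 sK sE).
- by rewrite s1 oner_neq0.
- exact: derivable_Smob_near0.
have [dl dl0 Hdl] := @lagrange_series0 R 2 ltac:(by rewrite gt_eqF// ltr1n).
have [d1 d10 H1] := @mob_small R p (p - 1) (Num.min (1/2) dl) p0
  ltac:(by rewrite lt_min divr_gt0).
(* Taken for its denominator p - 1 + (p - 2) z, which up to sign and (1 + z)^2 is the coefficient p
   w - (p - 1) of M_sigma(w) in the final equation. *)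
have [d2 d20 H2] := @mob_small R (p - 1) (p - 2) 1 q0 ltr01.
exists (Num.min d1 d2); first by rewrite lt_min d10.
move=> z; rewrite lt_min => /andP[/H1[h1 + z2] /H2[h2 _ _]].
rewrite lt_min => /andP[y2 /Hdl]; set y := mob p (p - 1) z in y2 *.
set u := y * cpow _ _; rewrite -/(central_binomial R) => hB.
set w := z / (1 + z) * _ => w2.
have hM : geo_approx (fun N => \sum_(n < N) (s n)%:C * w ^+ n) (Mtransform sigma w).
  by exists 4 => N; rewrite normc_distrC; exact: (Mtransform_series K0 sK sE N w2).
(* The partial sums converge to M_sigma(w), so the recursion for the moments
   becomes a linear equation for M_sigma(w). *)
suff -> : 1 + z = Mtransform sigma w by [].
have z1 : 1 + z != 0 by apply: Re_gt0_neq0; have := Re_1D_gt0 z2; lra.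
have y1 : 1 + y != 0 by apply: Re_gt0_neq0; have := Re_1D_gt0 (ltW y2); lra.
have yE : 1 + y = p%:C * (1 + z) / (p%:C + (p%:C - 1) * z) := one_add_mob h1.
have n0 : p%:C + (p%:C - 1) * z != 0 by rewrite -(rmorph1 (real_complex R)) -rmorphB.
have uE : u = y / (1 + y) ^+ 2.
  by rewrite /u cpowN// -(mulr1 2) -cpowX// cpow1.
have uzE : u = z * (p%:C + (p%:C - 1) * z) / (p%:C * (1 + z)) ^+ 2.
  rewrite uE yE /y /mob rmorphB rmorph1; field.
  by rewrite P0 z1 n0.
have wE : w = p%:C * u.
  rewrite uzE /w /Smob -/y yE rmorph1; field.
  by rewrite P0 z1 n0.
pose T N := \sum_(n < N) (s n)%:C * w ^+ n.
pose B N := \sum_(n < N) (central_binomial R n)%:C * u ^+ n.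
(* The recursion for the moments, multiplied by w^(n + 1) with w = p u and summed over n < N; the
   shifted sums lose their zeroth term 1. *)
have TB N : p%:C * w * T N - (p%:C - 1) * (T N.+1 - 1) =
    p%:C / 2 * (4 * u * B N - (B N.+1 - 1)).
  elim: N => [|N IH].
    by rewrite /T /B !big_ord_recl !big_ord0/= s0 b0 !expr0; ring.
  have -> : T N.+2 = T N.+1 + (s N.+1)%:C * w ^+ N.+1 by rewrite /T big_ord_recr.
  have -> : B N.+2 = B N.+1 + (central_binomial R N.+1)%:C * u ^+ N.+1 by rewrite /B big_ord_recr.
  have BN : B N.+1 = B N + (central_binomial R N)%:C * u ^+ N by rewrite /B big_ord_recr.
  have TN : T N.+1 = T N + (s N)%:C * w ^+ N by rewrite /T big_ord_recr.
  have r : p%:C * (s N)%:C - (p%:C - 1) * (s N.+1)%:C =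
      p%:C ^- N * ((4 * (central_binomial R N)%:C - (central_binomial R N.+1)%:C) / 2).
    move: (central_binomial R N) (central_binomial R N.+1) (s N) (s N.+1) (srec N) => c c' t t'.
    move=> /(congr1 (real_complex R)).
    by rewrite !(rmorphB, rmorphM, rmorphXn, fmorphV, rmorph_nat, rmorph1) exprVn.
  transitivity (p%:C * w * T N - (p%:C - 1) * (T N.+1 - 1) +
      w ^+ N.+1 * (p%:C * (s N)%:C - (p%:C - 1) * (s N.+1)%:C)).
    by rewrite {1}TN exprS; move: (T N.+1) (s N) (s N.+1) => a b c; ring.
  rewrite IH r wE exprMn BN.
  move: (central_binomial R N) (central_binomial R N.+1) (B N) => c c' b.
  by rewrite !exprS; field; rewrite expf_neq0.
have hB1 := hB; rewrite (_ : 2 - 1 = 1 :> R) in hB1; last by ring.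
have hMr := geo_approxB (geo_approxZ (p%:C * w) hM) (geo_approxZ (p%:C - 1)
  (geo_approxB (proj1 (geo_approxS _ _) hM) (geo_approx_cst 1))).
have hBr := geo_approxZ (p%:C / 2) (geo_approxB (geo_approxZ (4 * u) hB1)
  (geo_approxB (proj1 (geo_approxS _ _) hB1) (geo_approx_cst 1))).
have := geo_approx_unique hMr (eq_geo_approx (fun N => esym (TB N)) erefl hBr).
rewrite rmorph1 mul1r; move: (Mtransform sigma w) => M MB.
have y10 : 1 - y != 0.
  by rewrite -normc_gt0 (lt_le_trans _ (lerB_normc _ _))// normc1 normc_opp; lra.
have m0 : p%:C - 1 + (p%:C - 2) * z != 0.
  by have := h2; rewrite !rmorphB rmorph1 rmorph_nat.
have wp : p%:C * w - (p%:C - 1) = - ((p%:C - 1 + (p%:C - 2) * z) / (1 + z) ^+ 2).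
  by rewrite wE uzE; field; rewrite P0 z1.
have wp0 : p%:C * w - (p%:C - 1) != 0 by rewrite wp oppr_eq0 mulf_neq0// invr_neq0// expf_neq0.
have yz : p%:C * y / (1 + y) = z / (1 + z).
  rewrite yE /y /mob rmorphB rmorph1; field.
  by rewrite P0 z1 n0.
apply: (mulfI wp0).
transitivity (p%:C * w * M - (p%:C - 1) * (M - 1) - (p%:C - 1)); last by ring.
rewrite MB uE wp.
(* The right-hand side is p u C(u), where C(u) = 1 + y is the Catalan generating function at u = y /
   (1 + y)^2. *)
have -> : p%:C / 2 * (4 * (y / (1 + y) ^+ 2) * ((1 + y) / (1 - y)) - ((1 + y) / (1 - y) - 1)) =
    p%:C * y / (1 + y) by field; rewrite y1 y10.
by rewrite yz; field.
Qed.

End proposition.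

Lemma gbinom1 (R : realType) (a : R) : gbinom a 1 = a.
Proof. by have := gbinomS a 0; rewrite gbinom0 mul1r subr0 mulr1. Qed.

(** With t = p / (p - 1), the factor 1 / t cancels the constant of [Smob], and rescaling z
    multiplies the first coefficient of [mob] by t, turning p - 1 into p. *)
Lemma additive_power_mob (R : realType) (p : R) : 1 < p ->
  (fun z => ((p / (p - 1))%:C)^-1 *
     Smob (p - 1) (p - 1) (p / (p - 1)) (z / (p / (p - 1))%:C)) =
  Smob p (p - 1) 1.
Proof.
move=> p1; have p0 : 0 < p by exact: lt_trans p1.
have q0 : 0 < p - 1 by rewrite subr_gt0.
have t0 : (p / (p - 1))%:C != 0 by rewrite (inj_eq (@complexI R)) mulf_neq0 ?invr_neq0 ?gt_eqF.
apply/funext => z; rewrite /Smob mulKf// mul1r; congr (1 + _)^-1.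
rewrite /mob -mulrA -invfM; congr (_ / _).
rewrite mulrDr mulrCA [_ * (z / _)]mulrCA divff// mulr1.
by rewrite -rmorphM/= divfK ?gt_eqF.
Qed.

(** The moments of [rho] carry c^(-n) and the argument of its M-transform carries c^n, so its
    partial sums are those of nu. *)
Lemma dilated_term (R : realType) (c g : R) (e : R[i]) n : c != 0 ->
  (c^-1 ^+ n * g)%:C * (c%:C * e) ^+ n = g%:C * e ^+ n.
Proof.
move=> c0; have cC : c%:C != 0 by rewrite (inj_eq (@complexI R)).
rewrite rmorphM rmorphXn fmorphV/= exprMn exprVn.
by move: c%:C cC => C C0; field; rewrite expf_neq0.
Qed.

Lemma nu_m1_is_dilated_free_power (R : realType) (p : R) (p1 : 1 < p) (nu : probR R) :
  is_nu p (- 1) nu ->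
  exists rho : probR R, is_free_mul_power (two_atoms p1) p rho /\
    same_measure nu (dilation (p `^ p * (p - 1) `^ (1 - p)) rho).
Proof.
move=> /is_nuP[K K0 [nuK nuE]].
have p0 : 0 < p by exact: lt_trans p1.
have q0 : 0 < p - 1 by rewrite subr_gt0.
have k0 : 0 < p / (p - 1) by rewrite divr_gt0.
set c := _ * _.
have c0 : 0 < c by rewrite mulr_gt0 ?powR_gt0.
(* Here z / (1 + z) = (p - 1) y, and the p-th power of the S-transform brings the constant (p / (p -
   1))^p; their product is the dilation factor. *)
have cE : c = (p - 1) * (p / (p - 1)) `^ p.
  have powV : (p - 1)^-1 `^ p = ((p - 1) `^ p)^-1.
    by rewrite -powR_inv1 ?(ltW q0)// -powRrM mulN1r powRN.
  rewrite /c powRM ?invr_ge0 ?(ltW p0) ?(ltW q0)// powV powRB; last first.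
    by rewrite (gt_eqF q0) implybT.
  by rewrite powRr1 ?(ltW q0)// mulrCA.
have [rho [nurho rhoK rhoE]] := dilation_exists c0 K0 nuK nuE.
exists rho; split => //; exists (Smob (p - 1) (p - 1) (p / (p - 1))).
  exact: is_Stransform_two_atoms.
apply: (is_StransformI _ rhoK rhoE).
- by rewrite mulr_gt0// invr_gt0.
- by rewrite gbinom1 mul1r mulf_neq0 ?expf_neq0 ?invr_neq0 ?gt_eqF.
- exact: derivable_cpow_Smob_near0.
have [dl dl0 Hdl] := lagrange_series p.
have [d d0 H] := @mob_small R (p - 1) (p - 1) (Num.min (1/2) dl) q0
  ltac:(by rewrite lt_min divr_gt0).
exists d => // z /H[h1 + z2] _.
rewrite lt_min => /andP[y2 /Hdl]; set y := mob _ _ z in y2 *.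
have r0 : 0 < Re (1 + y) by have := Re_1D_gt0 (ltW y2); lra.
have z1 : 1 + z != 0 by apply: Re_gt0_neq0; have := Re_1D_gt0 z2; lra.
rewrite cpow_Smob// -/y.
have P1 : (p - 1)%:C != 0 by rewrite (inj_eq (@complexI R)) gt_eqF.
have yE : y = z / ((p - 1)%:C * (1 + z)) by rewrite /y /mob mulrDr mulr1.
have wE : z / (1 + z) * (((p / (p - 1)) `^ p)%:C * cpow (1 + y) (- p)) =
    c%:C * (y * cpow (1 + y) (- p)).
  rewrite cE rmorphM yE /=; move: (p - 1)%:C P1 (_ `^ p)%:C (cpow _ _) => Q Q0 k' e.
  by field; rewrite Q0 z1.
apply: eq_geo_approx => [N|].
  by rewrite wE; apply: eq_bigr => n _; rewrite dilated_term// gt_eqF.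
rewrite yE; move: (p - 1)%:C P1 => Q Q0; field.
by rewrite z1 Q0 addrK oner_neq0.
Qed.

Lemma nu_0_is_dilated_free_power (R : realType) (p : R) (p1 : 1 < p) (nu : probR R) :
  is_nu p 0 nu ->
  exists sigma rho : probR R,
    [/\ is_free_add_power (two_atoms p1) (p / (p - 1)) sigma,
      is_free_mul_power sigma (p - 1) rho & same_measure nu (dilation p rho)].
Proof.
move=> /is_nuP[K K0 [nuK nuE]].
have p0 : 0 < p by exact: lt_trans p1.
have q0 : 0 < p - 1 by rewrite subr_gt0.
have [sigma sigmaS] := is_Stransform_additive_power p1.
have [rho [nurho rhoK rhoE]] := dilation_exists p0 K0 nuK nuE.
exists sigma, rho; split => //.
  exists (Smob (p - 1) (p - 1) (p / (p - 1))).
    exact: is_Stransform_two_atoms.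
  by rewrite additive_power_mob.
exists (Smob p (p - 1) 1) => //.
apply: (is_StransformI _ rhoK rhoE).
- by rewrite mulr_gt0// invr_gt0.
- by rewrite gbinom1 mul1r addr0 mulf_neq0 ?expf_neq0 ?invr_neq0 ?gt_eqF.
- exact: derivable_cpow_Smob_near0.
have [dl dl0 Hdl] := @lagrange_series0 R p ltac:(by rewrite gt_eqF).
have [d d0 H] := @mob_small R p (p - 1) (Num.min (1/2) dl) p0
  ltac:(by rewrite lt_min divr_gt0).
exists d => // z /H[h1 + z2] _.
rewrite lt_min => /andP[y2 /Hdl]; set y := mob _ _ z in y2 *.
have r0 : 0 < Re (1 + y) by have := Re_1D_gt0 (ltW y2); lra.
have z1 : 1 + z != 0 by apply: Re_gt0_neq0; have := Re_1D_gt0 z2; lra.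
rewrite cpow_Smob// -/y powR1 mul1r.
have P0 : p%:C != 0 by rewrite (inj_eq (@complexI R)) gt_eqF.
have n0 : p%:C + (p%:C - 1) * z != 0 by rewrite -(rmorph1 (real_complex R)) -rmorphB.
have yE : y = z / (p%:C + (p%:C - 1) * z) by rewrite /y /mob rmorphB rmorph1.
have y1E : 1 + y = p%:C * (1 + z) / (p%:C + (p%:C - 1) * z) by rewrite yE; field.
(* As z / (1 + z) = p y / (1 + y), the exponent drops from 1 - p to -p and the factor p is the
   dilation. *)
have wE : z / (1 + z) * cpow (1 + y) (- (p - 1)) = p%:C * (y * cpow (1 + y) (- p)).
  rewrite opprB [1 - p]addrC cpowD ?Re_gt0_neq0// cpow1 ?Re_gt0_neq0//.
  move: (cpow (1 + y) _) => e; rewrite y1E yE; field.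
  by rewrite n0 z1.
apply: eq_geo_approx => [N|].
  by rewrite wE; apply: eq_bigr => n _; rewrite dilated_term// gt_eqF.
rewrite y1E yE rmorphB rmorph1.
field.
have -> : p%:C + (p%:C - 1) * z - (p%:C - 1) * z = p%:C by ring.
by rewrite P0 n0.
Qed.

Theorem proposition6p3 (R : realType) (p : R) (p1 : 1 < p) :
  (forall nu : probR R, is_nu p (- 1) nu ->
     exists rho : probR R,
       is_free_mul_power (two_atoms p1) p rho /\
       same_measure nu (dilation (p `^ p * (p - 1) `^ (1 - p)) rho)) /\
  (forall nu : probR R, is_nu p 0 nu ->
     exists sigma rho : probR R,
       [/\ is_free_add_power (two_atoms p1) (p / (p - 1)) sigma,
           is_free_mul_power sigma (p - 1) rho &
           same_measure nu (dilation p rho)]).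
Proof.
split=> nu.
  exact: nu_m1_is_dilated_free_power.
exact: nu_0_is_dilated_free_power.
Qed.
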